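(* For all integers $d, n$ with $0 < d < n$, one has $\sigma_{d,n} \geq 1/2$, where $$\sigma_{d,n} := \min\left\{\sigma > 0 \ :\ \text{for any } d\text{-set } E \subset \mathbb{R}^{n},\ \ \Theta_{\ast}^{d}(E,x) > \sigma \text{ for } \mathcal{H}^{d}\text{-a.e. } x \in E \implies E \text{ is } d\text{-rectifiable}\right\}.$$
   Context: Let $0<d<n$ be integers. The $d$-dimensional Hausdorff measure is normalized without any dimensional constant: $\mathcal{H}^{d}_{\delta}(E) = \inf\{\sum_{i=1}^{\infty}\operatorname{diam}(U_i)^{d} : E \subset \bigcup_{i=1}^{\infty} U_i,\ \operatorname{diam}(U_i) \leq \delta\}$ and $\mathcal{H}^{d}(E) = \lim_{\delta\to 0}\mathcal{H}^{d}_{\delta}(E)$. With this convention a $d$-dimensional ball $B$ satisfies $\mathcal{H}^d(B)=\operatorname{diam}(B)^d$. A $d$-set in $\mathbb{R}^{n}$ is a Borel set $E \subset \mathbb{R}^{n}$ with $0 < \mathcal{H}^{d}(E) < \infty$. The lower $d$-density of $E$ at $x \in \mathbb{R}^{n}$ is $\Theta_{\ast}^{d}(E,x) = \liminf_{r \to 0} \frac{\mathcal{H}^{d}(E \cap B_{r}(x))}{(2r)^{d}}$, where $B_r(x)$ is the ball of radius $r$ centered at $x$. A set $E \subset \mathbb{R}^{n}$ is $d$-rectifiable if, up to a set of zero $\mathcal{H}^{d}$-measure, it is contained in a countable union of images of Lipschitz maps with domain in $\mathbb{R}^{d}$. *)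

(* Defs.v *)
From HB Require Import structures.
From mathcomp Require Import all_boot all_order all_algebra.
From mathcomp Require Import all_classical all_reals all_analysis.

Set Implicit Arguments.
Unset Strict Implicit.
Unset Printing Implicit Defensive.

Import Order.TTheory GRing.Theory Num.Theory.
Import numFieldNormedType.Exports.

Local Open Scope classical_set_scope.
Local Open Scope ring_scope.

(* The norm of the library on 'rV[R]_n is the sup norm, so the Euclidean
   distance is defined here; both induce the same topology. *)
Definition edist (R : realType) (n : nat) (x y : 'rV[R]_n) : R :=
  Num.sqrt (\sum_(i < n) (x ord0 i - y ord0 i) ^+ 2).

Definition eball (R : realType) (n : nat) (x : 'rV[R]_n) (r : R) :
    set 'rV[R]_n :=
  [set y | edist x y < r].

(* The supremum is taken in [0, +oo]: the point 0 is adjoined so that the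
   empty set has diameter 0 (ereal_sup set0 is -oo). *)
Definition diam (R : realType) (n : nat) (U : set 'rV[R]_n) : \bar R :=
  ereal_sup ([set 0%E] `|`
             [set e | exists x y, [/\ U x, U y & e = (edist x y)%:E]]).

Definition hausdorff_delta (R : realType) (n d : nat) (delta : R)
    (E : set 'rV[R]_n) : \bar R :=
  ereal_inf [set s : \bar R | exists U : nat -> set 'rV[R]_n,
    [/\ E `<=` \bigcup_i U i,
        forall i, (diam (U i) <= delta%:E)%E &
        s = (\sum_(0 <= i <oo) (diam (U i) ^+ d))%E]].

(* No dimensional constant. Since hausdorff_delta is monotone in delta, the
   limit always exists in \bar R. *)
Definition hausdorff (R : realType) (n d : nat) (E : set 'rV[R]_n) : \bar R :=
  lim (hausdorff_delta d delta E @[delta --> 0^'+]).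

Definition borel_set (R : realType) (n : nat) (E : set 'rV[R]_n) : Prop :=
  <<s [set U : set 'rV[R]_n | open U] >> E.

Definition d_set (R : realType) (n d : nat) (E : set 'rV[R]_n) : Prop :=
  [/\ borel_set E, (0 < hausdorff d E)%E & (hausdorff d E < +oo)%E].

(* The one-sided filter 0^'+ is essential: for r <= 0 the ball is empty. *)
Definition lower_density (R : realType) (n d : nat) (E : set 'rV[R]_n)
    (x : 'rV[R]_n) : \bar R :=
  limf_einf (fun r : R =>
    (hausdorff d (E `&` eball x r) * (((2 * r) ^+ d)^-1)%:E)%E) 0^'+.

Definition lipschitz_from (R : realType) (d n : nat) (A : set 'rV[R]_d)
    (f : 'rV[R]_d -> 'rV[R]_n) : Prop :=
  exists L : R, forall x y, A x -> A y -> edist (f x) (f y) <= L * edist x y.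

(* The domains A i are arbitrary subsets of R^d; the values of f i outside
   A i are irrelevant. *)
Definition rectifiable (R : realType) (n d : nat) (E : set 'rV[R]_n) : Prop :=
  exists (A : nat -> set 'rV[R]_d) (f : nat -> 'rV[R]_d -> 'rV[R]_n),
    (forall i, lipschitz_from (A i) (f i)) /\
    hausdorff d (E `\` \bigcup_i (f i @` A i)) = 0%E.

Definition hausdorff_ae (R : realType) (n d : nat) (E : set 'rV[R]_n)
    (P : 'rV[R]_n -> Prop) : Prop :=
  hausdorff d [set x | E x /\ ~ P x] = 0%E.

Definition density_thresholds (R : realType) (d n : nat) : set R :=
  [set s | 0 < s /\
    forall E : set 'rV[R]_n, d_set d E ->
      hausdorff_ae d E (fun x => (s%:E < lower_density d E x)%E) ->
      rectifiable d E].
Arguments density_thresholds R d n : clear implicits.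

(* sigma_{d,n}: the minimum is rendered as the infimum in \bar R, with which it
   coincides (sigma_min below). *)
Definition sigma (R : realType) (d n : nat) : \bar R :=
  ereal_inf [set s%:E | s in density_thresholds R d n].
Arguments sigma R d n : clear implicits.

Lemma sigma_min (R : realType) (d n : nat) (s : R) :
  density_thresholds R d n s ->
  (forall t, density_thresholds R d n t -> s <= t) ->
  sigma R d n = s%:E.
Proof.
move=> Ss smin; apply/eqP; rewrite eq_le; apply/andP; split.
  by apply: ereal_inf_lbound; exists s.
by apply: le_ereal_inf_tmp => _ [t St <-]; rewrite lee_fin smin.
Qed.

(* Main.v *)
Require Import Defs.
From mathcomp Require Import all_boot all_order all_algebra.
From mathcomp Require Import all_classical all_reals all_analysis.
From mathcomp Require Import measurable_realfun finmap zify ring lra.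
Import Defs.

Set Implicit Arguments.
Unset Strict Implicit.
Unset Printing Implicit Defensive.

(* The extremal set is the graph, over the unit cube of R^d, of
     height = sum_k jump k * corner_code k,
   where the level-k grid has cells of side 1 / mesh k, the code takes 2^d
   values and separates adjacent cells, and jump k = 1 / ((k + 1) * mesh k).

   Lower density. Let M * jump (k + 1) <= h < M * jump k. Unless x is within
   M * jump k of two non-parallel faces of its level-k cell, half of the ball of
   radius h about x lies in that cell, and over it the graph is flat up to
   2^(d + 1) * h / M. The exceptional sets have measure O(1 / k^2), so by
   Borel-Cantelli the lower density is almost everywhere at least
   (1 - 2^(d + 1) / M)^d / 2, with M arbitrarily large. That a d-ball has measure
   diam^d is the isodiametric inequality, which is deduced from a
   Brunn-Minkowski inequality for finite sets of lattice points.

   Unrectifiability. Pieces of the graph over distinct level-k cells are at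
   distance at least jump k / 2. If g : A -> graph is Lipschitz with A bounded,
   the preimages of these pieces therefore have disjoint neighbourhoods of radius
   r_k comparable to jump k. By an isoperimetric inequality on each of them, the
   volume of the r_k-neighbourhood of A exceeds that of the
   r_(k+1)-neighbourhood by a constant times
   jump k * mesh k * H^d(g(A)) = H^d(g(A)) / (k + 1). The harmonic series
   diverges, so H^d(g(A)) = 0. Neighbourhoods are measured by counting
   the cells of a fine grid, which keeps the whole argument finite. *)

(** * Counting in integer grids *)

(** Points are lists, so that slicing by the first coordinate is matching on [::] and induction on
    the dimension is structural. *)
Definition grid (B d : nat) : seq (seq nat) :=
  iter d (fun G => [seq a :: s | a <- iota 0 B, s <- G]) [:: [::]].

Lemma gridS B d : grid B d.+1 = [seq a :: s | a <- iota 0 B, s <- grid B d].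
Proof. by []. Qed.

Lemma mem_grid B d s : (s \in grid B d) = (size s == d) && all (gtn B) s.
Proof.
elim: d s => [|d IHd] s; first by rewrite inE; case: s.
rewrite gridS; apply/allpairsP/idP => [[[a t] /= [Ba]]|].
  rewrite IHd => /andP[/eqP st Bt] ->; rewrite /= st eqxx Bt andbT.
  by move: Ba; rewrite mem_iota.
case: s => [|a s]//= /andP[ss /andP[aB sB]].
by exists (a, s); rewrite mem_iota IHd; split=> //; apply/andP.
Qed.

Lemma mem_gridP B d s :
  reflect (size s = d /\ forall i, i < d -> nth 0 s i < B) (s \in grid B d).
Proof.
rewrite mem_grid; apply: (iffP andP) => -[].
  by move=> /eqP sd /all_nthP sB; split=> // i id; apply: sB; rewrite sd.
by move=> sd sB; split; [exact/eqP|apply/(all_nthP 0) => i; rewrite sd; exact: sB].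
Qed.

Lemma grid_uniq B d : uniq (grid B d).
Proof.
elim: d => [|d IHd]//; rewrite gridS allpairs_uniq ?iota_uniq//.
by move=> [a s] [b t] _ _ /= [-> ->].
Qed.

Lemma size_grid B d : size (grid B d) = B ^ d.
Proof. by elim: d => // d IHd; rewrite gridS size_allpairs size_iota IHd expnS. Qed.

Lemma grid_eq B d s t : s \in grid B d -> size t = d ->
  (forall i, i < d -> nth 0 s i = nth 0 t i) -> s = t.
Proof.
move=> /mem_gridP[sd _] td st; apply: (@eq_from_nth _ 0); rewrite sd//.
Qed.

Definition cnt (B d : nat) (P : pred (seq nat)) : nat :=
  \sum_(s <- grid B d) P s.

Lemma cntE B d P : cnt B d P = size [seq s <- grid B d | P s].
Proof. by rewrite size_filter /cnt -sum1_count [RHS]big_mkcond; apply: eq_bigr => i _; case: (P i). Qed.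

Lemma cnt0 B P : cnt B 0 P = P [::].
Proof. by rewrite /cnt big_seq1. Qed.

Lemma sum_iota n (F : nat -> nat) : \sum_(a <- iota 0 n) F a = \sum_(a < n) F a.
Proof. by rewrite -{1}(subn0 n) -/(index_iota 0 n) big_mkord. Qed.

Lemma cntS B d P : cnt B d.+1 P = \sum_(a < B) cnt B d (fun s => P (nat_of_ord a :: s)).
Proof.
by rewrite /cnt gridS big_allpairs_dep /= sum_iota.
Qed.

Lemma cnt_le B d (P Q : pred (seq nat)) :
  (forall s, s \in grid B d -> P s -> Q s) -> cnt B d P <= cnt B d Q.
Proof.
move=> PQ; rewrite /cnt big_seq [leqRHS]big_seq; apply: leq_sum => s sB.
by case Ps: (P s); rewrite // PQ.
Qed.

Lemma cnt_inj B d B' d' (P Q : pred (seq nat)) (phi : seq nat -> seq nat) :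
  (forall s, s \in grid B d -> P s -> phi s \in grid B' d' /\ Q (phi s)) ->
  {in [pred s in grid B d | P s] &, injective phi} ->
  cnt B d P <= cnt B' d' Q.
Proof.
move=> PQ phiI; rewrite !cntE -(size_map phi).
apply: uniq_leq_size.
  rewrite map_inj_in_uniq ?filter_uniq ?grid_uniq// => s t.
  by rewrite !mem_filter => /andP[Ps sB] /andP[Pt tB]; apply: phiI; rewrite inE ?sB ?tB.
move=> u /mapP[s]; rewrite mem_filter => /andP[Ps sB] ->.
by rewrite mem_filter; case: (PQ s sB Ps) => -> ->.
Qed.

Lemma cnt_sum B d (T : Type) (r : seq T) (P : T -> pred (seq nat)) :
  \sum_(u <- r) cnt B d (P u) = \sum_(s <- grid B d) \sum_(u <- r) P u s.
Proof. by rewrite exchange_big. Qed.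

Lemma leq_cnt_union B d (T : eqType) (r : seq T) (P : pred (seq nat))
    (Q : T -> pred (seq nat)) :
  (forall s, s \in grid B d -> P s -> exists2 u, u \in r & Q u s) ->
  cnt B d P <= \sum_(u <- r) cnt B d (Q u).
Proof.
move=> PQ; rewrite cnt_sum /cnt big_seq [leqRHS]big_seq; apply: leq_sum => s sB.
case Ps : (P s) => //; have [u ur Qus] := PQ s sB Ps.
by rewrite (big_rem u)//= Qus.
Qed.

Lemma leq_cnt_disjoint B d (T : eqType) (r : seq T) (P : pred (seq nat))
    (Q : T -> pred (seq nat)) : uniq r ->
  (forall u s, u \in r -> s \in grid B d -> Q u s -> P s) ->
  (forall u v s, u \in r -> v \in r -> s \in grid B d -> Q u s -> Q v s -> u = v) ->
  \sum_(u <- r) cnt B d (Q u) <= cnt B d P.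
Proof.
move=> ur QP Qdis; rewrite cnt_sum /cnt big_seq [leqRHS]big_seq; apply: leq_sum => s sB.
have [/hasP[u uinr Qus]|/hasPn nQ] := boolP (has (Q^~ s) r); last first.
  by rewrite big_seq big1// => u /nQ /negbTE ->.
rewrite (QP u s)// (bigD1_seq u)//= Qus big_seq_cond big1// => v /andP[vr /eqP vu].
by case Qvs : (Q v s) => //; exfalso; apply: vu; exact: (Qdis v u s).
Qed.

(** * Sumsets and a discrete Brunn-Minkowski inequality *)

Lemma sum_shift_le (F G : nat -> nat) l n m k : n + m <= k ->
  (forall a, l <= a < n -> F a <= G (a + m)) ->
  \sum_(l <= a < n) F a <= \sum_(l + m <= w < k) G w.
Proof.
move=> nmk FG; have [ln|nl] := leqP l n; last by rewrite big_geq// ltnW.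
rewrite [leqRHS](@big_cat_nat _ _ _ (n + m)) ?leq_add2r//=.
apply: leq_trans (leq_addr _ _).
rewrite big_addn addnK big_nat_cond [leqRHS]big_nat_cond.
by apply: leq_sum => a; rewrite andbT; exact: FG.
Qed.

Lemma sum_pred_restrict (P : pred nat) l k n : k <= n ->  l <= k ->
  (forall a, a < n -> P a -> l <= a < k) ->
  \sum_(a < n) P a = \sum_(l <= a < k) P a.
Proof.
move=> kn lk Plk; rewrite -(big_mkord xpredT (fun w => P w : nat)).
have z i j : j <= n -> (forall a, i <= a < j -> ~~ (l <= a < k)) ->
    \sum_(i <= a < j) P a = 0.
  move=> jn h; rewrite big_nat_cond big1// => a; rewrite andbT => aij.
  case Pa : (P a) => //; have := h a aij.
  by rewrite Plk//; lia.
have ln := leq_trans lk kn.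
rewrite (@big_cat_nat _ _ _ l 0 n)//= (@big_cat_nat _ _ _ k l n)//=.
by rewrite (z 0 l) ?(z k n) ?addn0//; move=> a; lia.
Qed.

(* With [a] the largest element of [P] and [b] the least element of [Q], the
   translates [P + b] and [Q + a + 1] are disjoint. *)
Lemma sumset_card_ge (N x0 y0 : nat) (P Q C : pred nat) :
  x0 < N -> P x0 -> y0 < N -> Q y0 ->
  (forall x y, x < N -> y < N -> P x -> Q y -> C (x + y) && C (x + y).+1) ->
  \sum_(x < N) P x + \sum_(y < N) Q y <= \sum_(w < N.*2) C w.
Proof.
move=> x0N Px0 y0N Qy0 PQC.
have exP : exists x, (x < N) && P x by exists x0; rewrite x0N.
have ubP x : (x < N) && P x -> x <= N by case/andP => /ltnW.
case: (ex_maxnP exP ubP) => a /andP[aN Pa] amax.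
have exQ : exists y, (y < N) && Q y by exists y0; rewrite y0N.
case: (ex_minnP exQ) => b /andP[bN Qb] bmin.
rewrite (@sum_pred_restrict P 0 a.+1)//; last first.
  by move=> x xN Px; rewrite ltnS amax// xN.
rewrite (@sum_pred_restrict Q b N)//; [|exact: ltnW|]; last first.
  by move=> y yN Qy; rewrite yN bmin// yN.
rewrite -(big_mkord xpredT (fun w => C w : nat)) (@big_cat_nat _ _ _ (b + a.+1) 0 N.*2) //=; last lia.
rewrite [in leqRHS](@big_cat_nat _ _ _ (0 + b) 0 (b + a.+1))//=; last lia.
apply: leq_add; last first.
  apply: sum_shift_le => [|y /andP[_ yN]]; first lia.
  case Qy : (Q y) => //; have /andP[_] := PQC a y aN yN Pa Qy.
  by rewrite -addnS addnC addSn -addnS => ->.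
apply: leq_trans (leq_addl _ _); apply: sum_shift_le => [|x /andP[_ xa]]; first lia.
case Px : (P x) => //.
by have /andP[->] := PQC x b (leq_trans xa aN) bN Px Qb.
Qed.

Lemma sum_ltn_layers T m : m <= T -> \sum_(t < T) (t < m) = m.
Proof.
move=> mT; rewrite (@sum_pred_restrict (fun t => t < m) 0 m)//.
rewrite big_nat_cond (eq_bigr (fun=> 1)); last by move=> i; rewrite andbT /= => ->.
by rewrite -big_nat_cond sum_nat_const_nat muln1 subn0.
Qed.

Lemma sum_ltn_layers_le T m : \sum_(t < T) (t < m) <= m.
Proof.
have [mT|/ltnW Tm] := leqP m T; first by rewrite sum_ltn_layers.
apply: leq_trans Tm; rewrite -[leqRHS]card_ord -sum1_card.
by apply: leq_sum => i _; case: (_ < _).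
Qed.

(* One-dimensional Prekopa-Leindler for functions with a common maximum [T]:
   apply the sumset bound to each superlevel set. *)
Lemma pl_common_max (N T x0 y0 : nat) (f g h : nat -> nat) :
  (forall x, x < N -> f x <= T) -> (forall y, y < N -> g y <= T) ->
  x0 < N -> f x0 = T -> y0 < N -> g y0 = T ->
  (forall x y, x < N -> y < N ->
     minn (f x) (g y) <= h (x + y) /\ minn (f x) (g y) <= h (x + y).+1) ->
  \sum_(x < N) f x + \sum_(y < N) g y <= \sum_(w < N.*2) h w.
Proof.
move=> fT gT x0N fx0 y0N gy0 fgh.
have layer (F : nat -> nat) : (forall x, x < N -> F x <= T) ->
    \sum_(x < N) F x = \sum_(t < T) \sum_(x < N) (t < F x).
  move=> FT; rewrite exchange_big/=; apply: eq_bigr => x _.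
  by rewrite sum_ltn_layers// FT.
rewrite (layer f)// (layer g)// -big_split/=.
apply: (@leq_trans (\sum_(t < T) \sum_(w < N.*2) (t < h w))); last first.
  by rewrite exchange_big/=; apply: leq_sum => w _; exact: sum_ltn_layers_le.
apply: leq_sum => t _.
apply: (@sumset_card_ge N x0 y0 (fun x => t < f x) (fun x => t < g x) (fun x => t < h x)) => //.
- by rewrite fx0.
- by rewrite gy0.
move=> x y xN yN tf tg; have [h1 h2] := fgh x y xN yN.
by rewrite !(leq_trans _ h1, leq_trans _ h2)// leq_min tf.
Qed.

(** Multiplying the hypotheses for [i] and [j] and taking the square root gives
    [F i * F j <= K * (G i * G j)], which is summed over all pairs. *)
Lemma sum_sqr_le n (F G : 'I_n -> nat) (K : nat) :
  (forall i, F i ^ 2 <= K * G i ^ 2) ->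
  (\sum_i F i) ^ 2 <= K * (\sum_i G i) ^ 2.
Proof.
move=> FG; rewrite -!mulnn !big_distrlr/= big_distrr/=; apply: leq_sum => i _.
rewrite big_distrr/=; apply: leq_sum => j _.
have := leq_mul (FG i) (FG j).
by rewrite -expnMn mulnACA mulnn -(expnMn (G i)) -expnMn leq_sqr.
Qed.

(** One-dimensional Prekopa-Leindler inequality, squared so that geometric means stay in [nat]; [b]
    carries the constant of the lower dimensions. Rescaling [f] and [g] by each other's maximum
    reduces it to a common maximum. *)
Lemma pl1d (N b : nat) (f g h : nat -> nat) :
  (forall x y, x < N -> y < N ->
     b ^ 2 * (f x * g y) <= h (x + y) ^ 2 /\
     b ^ 2 * (f x * g y) <= h (x + y).+1 ^ 2) ->
  (b.*2) ^ 2 * ((\sum_(x < N) f x) * \sum_(y < N) g y)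
    <= (\sum_(w < N.*2) h w) ^ 2.
Proof.
move=> fgh.
have [N0|N0] := posnP N; first by subst N; rewrite !big_ord0 !muln0.
case: N N0 fgh => // N _ fgh.
have [x0 _ fmax] := @arg_maxnP _ ord0 xpredT (fun i : 'I_N.+1 => f i) isT.
have [y0 _ gmax] := @arg_maxnP _ ord0 xpredT (fun i : 'I_N.+1 => g i) isT.
set F := f x0 in fmax; set G := g y0 in gmax.
have fF x : x < N.+1 -> f x <= F by move=> xN; have := fmax (Ordinal xN) isT.
have gG x : x < N.+1 -> g x <= G by move=> xN; have := gmax (Ordinal xN) isT.
have [F0|F0] := posnP F.
  rewrite big1 ?mul0n ?muln0// => x _; apply/eqP; rewrite -leqn0 -F0; exact: fF.
have [G0|G0] := posnP G.
  rewrite [X in _ * (_ * X)]big1 ?muln0// => x _; apply/eqP; rewrite -leqn0 -G0; exact: gG.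
(* [k] is the least function that [pl_common_max] admits for [G * f] and [F * g], whose common
   maximum is [F * G]. *)
pose k w := \max_(x < N.+1) \max_(y < N.+1 | (x + y == w) || ((x + y).+1 == w))
   minn (G * f x) (F * g y).
have kh w : (b * k w) ^ 2 <= F * G * h w ^ 2.
  rewrite /k; elim/big_ind: _ => [|m n hm hn|x _]; first by rewrite muln0.
    by rewrite maxnMr; case: (leqP (b * m) (b * n)).
  elim/big_ind: _ => [|m n hm hn|y xyw]; first by rewrite muln0.
    by rewrite maxnMr; case: (leqP (b * m) (b * n)).
  apply: (@leq_trans (b ^ 2 * ((G * f x) * (F * g y)))).
    by rewrite expnMn leq_mul2l -[X in X ^ 2]/_ -mulnn leq_mul ?orbT// (geq_minl, geq_minr).
  rewrite (_ : _ * _ = F * G * (b ^ 2 * (f x * g y))); last first.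
    by rewrite mulnACA [G * F]mulnC mulnCA.
  rewrite leq_mul2l; apply/orP; right.
  have [h1 h2] := fgh x y (ltn_ord x) (ltn_ord y).
  by case/orP: xyw => /eqP <-.
have kk : \sum_(x < N.+1) G * f x + \sum_(y < N.+1) F * g y <= \sum_(w < N.+1.*2) k w.
  apply: (@pl_common_max _ (F * G) x0 y0 (fun x => G * f x) (fun y => F * g y)) => //.
  - by move=> x /fF fx; rewrite mulnC leq_mul2r fx orbT.
  - by move=> x /gG fx; rewrite leq_mul2l fx orbT.
  - exact: mulnC.
  move=> x y xN yN; split.
    rewrite /k (bigmax_sup (Ordinal xN))//.
    by rewrite (bigmax_sup (Ordinal yN))//= eqxx.
  rewrite /k (bigmax_sup (Ordinal xN))//.
  by rewrite (bigmax_sup (Ordinal yN))//= eqxx orbT.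
rewrite -(@leq_pmul2l (F * G)) ?muln_gt0 ?F0//.
rewrite -!big_distrr/= in kk.
have k2 := @sum_sqr_le _ (fun w : 'I_(N.+1.*2) => b * k w) (fun w => h w) (F * G) (fun w => kh w).
apply: leq_trans k2; rewrite -big_distrr/=.
set Sf := \sum_(x < N.+1) f x in kk *; set Sg := \sum_(x < N.+1) g x in kk *.
set Sk := \sum_(w < _) k w in kk *.
(* AM-GM turns the bound on the sum into one on the product; its factor 4 is the doubling of [b]. *)
have := (nat_AGM2 (G * Sf) (F * Sg)).
have : (G * Sf + F * Sg) ^ 2 <= Sk ^ 2 by rewrite leq_sqr.
rewrite -muln2 !expnMn => h1 h2.
rewrite (_ : _ * _ = b ^ 2 * (4 * (G * Sf * (F * Sg)))); last by (move: (b ^ 2) => B2; lia).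
by rewrite leq_mul2l (leq_trans h2 h1) orbT.
Qed.

(** The hypothesis says that [S] contains [P + Q + {0,1}^d]; the added cube makes up for
    discreteness. By induction on [d], the slices of [S] at [x + y] and [x + y + 1] are large
    whenever the slices of [P] at [x] and of [Q] at [y] are, and [pl1d] sums over the slices. *)
Theorem discrete_brunn_minkowski d N (P Q S : pred (seq nat)) :
  (forall p q w, p \in grid N d -> q \in grid N d -> size w = d -> P p -> Q q ->
     (forall i, i < d -> nth 0 w i = nth 0 p i + nth 0 q i \/
                         nth 0 w i = (nth 0 p i + nth 0 q i).+1) -> S w) ->
  (2 ^ d) ^ 2 * (cnt N d P * cnt N d Q) <= cnt N.*2 d S ^ 2.
Proof.
elim: d P Q S => [|d IHd] P Q S PQS.
  rewrite !cnt0; case Pn : (P [::]) => //; case Qn : (Q [::]) => //.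
  by rewrite (PQS [::] [::] [::])//.
rewrite !cntS [2 ^ d.+1]expnS mul2n.
apply: (@pl1d N (2 ^ d) (fun x => cnt N d (fun s => P (x :: s)))
  (fun x => cnt N d (fun s => Q (x :: s)))
  (fun x => cnt N.*2 d (fun s => S (x :: s)))) => x y xN yN.
have main e : (e = x + y \/ e = (x + y).+1) ->
   (2 ^ d) ^ 2 * (cnt N d (fun s => P (x :: s)) * cnt N d (fun s => Q (y :: s))) <=
     cnt N.*2 d (fun s => S (e :: s)) ^ 2.
  move=> exy; apply: IHd => p q w pN qN ws Pp Qq pqw.
  have ing a t : a < N -> t \in grid N d -> a :: t \in grid N d.+1.
    by rewrite !mem_grid /= eqSS => -> /andP[-> ->].
  apply: (PQS (x :: p) (y :: q)) => //; [exact: ing|exact: ing|by rewrite /= ws|].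
  by case=> [|i]//=; rewrite ltnS; exact: pqw.
by split; apply: main; [left|right].
Qed.

(** * Thickenings and a discrete isoperimetric inequality *)

(** Unfolded, this is the sum over all coordinate directions of the size of the projection of [P]
    along that direction: the shadow along a later coordinate is counted slice by slice. *)
Fixpoint shadow_sum (N d : nat) (P : pred (seq nat)) : nat :=
  if d is d'.+1 then
    cnt N d' (fun s => has (fun a => P (a :: s)) (iota 0 N)) +
    \sum_(a < N) shadow_sum N d' (fun s => P (nat_of_ord a :: s))
  else 0.

Lemma shadow_sum_le N d (P Q : pred (seq nat)) :
  (forall s, s \in grid N d -> P s -> Q s) -> shadow_sum N d P <= shadow_sum N d Q.
Proof.
elim: d P Q => // d IHd P Q PQ /=.
have ing a t : a < N -> t \in grid N d -> a :: t \in grid N d.+1.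
  by rewrite !mem_grid /= eqSS => -> /andP[-> ->].
apply: leq_add.
  apply: cnt_le => s sN /hasP[a aN Pas]; apply/hasP; exists a => //.
  by apply: PQ => //; apply: ing => //; rewrite mem_iota in aN.
by apply: leq_sum => a _; apply: IHd => s sN; apply: PQ; exact: ing.
Qed.

(* A weak Loomis-Whitney inequality: if some slice has more than [W ^ d] points
   then so has the first shadow; otherwise sum over the slices. *)
Lemma shadow_sum_ge N d W (P : pred (seq nat)) : 0 < d ->
  minn (cnt N d P) (W ^ d) <= W * shadow_sum N d P.
Proof.
case: d => // d _; elim: d P => [|d IHd] P.
  rewrite /= big1 // addn0 cnt0 expn1; case: hasP => [_|nP]; first by rewrite muln1 geq_minr.
  rewrite cntS big1 ?min0n// => a _; rewrite cnt0; case Pa : (P [:: _ & _]) => //.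
  by exfalso; apply: nP; exists (nat_of_ord a); rewrite ?mem_iota//=.
rewrite [shadow_sum _ _ _]/= -/shadow_sum mulnDr.
case: (boolP [forall a : 'I_N, cnt N d.+1 (fun s => P (nat_of_ord a :: s)) <= W ^ d.+1]).
  move=> /forallP small; rewrite geq_min; apply/orP; left.
  apply: leq_trans (leq_addl _ _); rewrite cntS big_distrr/=; apply: leq_sum => a _.
  by have := IHd (fun s => P (nat_of_ord a :: s)); rewrite (minn_idPl (small a)).
rewrite negb_forall => /existsP[a]; rewrite -ltnNge => big.
rewrite geq_min; apply/orP; right; apply: leq_trans (leq_addr _ _).
rewrite expnS leq_mul2l; apply/orP; right; apply: (leq_trans (ltnW big)).
by apply: cnt_le => s _ Pas; apply/hasP; exists (nat_of_ord a); rewrite ?mem_iota//=.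
Qed.

(** Minkowski sum with the cube [{0, ..., t}^d], one-sided so that no coordinate becomes
    negative. *)
Definition thicken (N d t : nat) (P : pred (seq nat)) : pred (seq nat) :=
  fun w => has (fun p => P p && all (fun i => nth 0 p i <= nth 0 w i <= nth 0 p i + t) (iota 0 d))
    (grid N d).

Lemma thickenP N d t (P : pred (seq nat)) w :
  reflect (exists p, [/\ p \in grid N d, P p &
     forall i, i < d -> nth 0 p i <= nth 0 w i <= nth 0 p i + t])
  (thicken N d t P w).
Proof.
apply: (iffP hasP) => [[p pN /andP[Pp /allP pw]]|[p [pN Pp pw]]]; exists p => //.
  by split=> // i id; apply: pw; rewrite mem_iota.
by rewrite Pp; apply/allP => i; rewrite mem_iota; exact: pw.
Qed.

(** If [a] is the largest element, the thickening contains the whole set, which ends at [a], and the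
    [t] new points after [a]. *)
Lemma thicken1d N t (P : pred nat) :
  \sum_(a < N) P a + t * has P (iota 0 N) <=
  \sum_(w < N + t) has (fun a => P a && (a <= w <= a + t)) (iota 0 N).
Proof.
case: hasP => [[a0]|nP]; last first.
  rewrite muln0 addn0 big1// => a _; case Pa : (P _) => //; exfalso; apply: nP.
  by exists (nat_of_ord a); rewrite ?mem_iota//=.
rewrite mem_iota/= add0n => a0N Pa0.
have exP : exists x, (x < N) && P x by exists a0; rewrite a0N.
have ubP x : (x < N) && P x -> x <= N by case/andP => /ltnW.
case: (ex_maxnP exP ubP) => a /andP[aN Pa] amax.
rewrite (@sum_pred_restrict P 0 a.+1)//; last first.
  by move=> x xN Px; rewrite ltnS amax// xN.
pose Q w := has (fun a => P a && (a <= w <= a + t)) (iota 0 N).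
rewrite -(big_mkord xpredT (fun w => Q w : nat)) (@big_cat_nat _ _ _ a.+1 0 (N + t)) //=; last lia.
apply: leq_add.
  rewrite big_nat_cond [leqRHS]big_nat_cond; apply: leq_sum => x; rewrite andbT => /andP[_ xa].
  case Px : (P x) => //; rewrite /Q lt0b; apply/hasP; exists x; first by rewrite mem_iota/=; lia.
  by rewrite Px leqnn leq_addr.
rewrite muln1 (@big_cat_nat _ _ _ (a.+1 + t) a.+1 (N + t)) ?leq_addr//=; last lia.
apply: leq_trans (leq_addr _ _).
apply: (@leq_trans (\sum_(a.+1 <= i < a.+1 + t) 1)).
  by rewrite sum_nat_const_nat muln1 addKn.
rewrite big_nat_cond [leqRHS]big_nat_cond; apply: leq_sum => x; rewrite andbT => /andP[ax xa].
rewrite /Q lt0b; apply/hasP; exists a; first by rewrite mem_iota/=; lia.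
by rewrite Pa; lia.
Qed.

Lemma cons_grid N d a t : a < N -> t \in grid N d -> a :: t \in grid N d.+1.
Proof. by rewrite !mem_grid /= eqSS => -> /andP[-> ->]. Qed.

Lemma leq_cnt_window N M d (P : pred (seq nat)) : N <= M -> cnt N d P <= cnt M d P.
Proof.
move=> NM; apply: (@cnt_inj _ _ _ _ _ _ id) => // s /mem_gridP[sd sN] Ps; split=> //.
by apply/mem_gridP; split=> // i id; exact: leq_trans (sN i id) NM.
Qed.

(** Every nonempty line gains [t] points. Thickening along the first coordinate gains [t] times the
    first shadow, and the slices [U w] so obtained contain the old ones, so the other shadows do not
    shrink. *)
Lemma cnt_thicken_shadow N d t (P : pred (seq nat)) :
  cnt N d P + t * shadow_sum N d P <= cnt (N + t) d (thicken N d t P).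
Proof.
elim: d P => [|d IHd] P.
  rewrite /= muln0 addn0 !cnt0; case Pn : (P [::]) => //; rewrite lt0b.
  by apply/thickenP; exists [::]; rewrite inE.
pose U w s := has (fun a => P (a :: s) && (a <= w <= a + t)) (iota 0 N).
rewrite [cnt (N + t) _ _]cntS.
apply: (@leq_trans (\sum_(w < N + t) (cnt N d (U w) + t * shadow_sum N d (U w)))).
  rewrite big_split/= -big_distrr/= mulnDr addnA; apply: leq_add.
    rewrite cntS /cnt big_distrr exchange_big/= -big_split/= exchange_big/=.
    by apply: leq_sum => s _; exact: (thicken1d N t (fun a => P (a :: s))).
  rewrite leq_mul2l; apply/orP; right.
  rewrite -(big_mkord xpredT (fun w => shadow_sum N d (U w))).
  rewrite (@big_cat_nat _ _ _ N 0)//= ?leq_addr//.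
  apply: leq_trans (leq_addr _ _); rewrite big_mkord; apply: leq_sum => a _.
  apply: shadow_sum_le => s _ Pas; apply/hasP; exists (nat_of_ord a).
    by rewrite mem_iota/=.
  by rewrite Pas leqnn leq_addr.
apply: leq_sum => w _; apply: leq_trans (IHd _) _.
apply: cnt_le => s sN /thickenP[p [pN /hasP[a]]].
rewrite mem_iota/= => aN /andP[Pap aw] ps; apply/thickenP; exists (a :: p); split=> //.
  exact: cons_grid.
by case=> [_|i]//=; rewrite ltnS; exact: ps.
Qed.

(** Isoperimetric inequality with denominators cleared: the gain is at least [t / W] times the
    volume truncated at [W ^ d]. *)
Theorem cnt_thicken N d t W (P : pred (seq nat)) : 0 < d ->
  t * minn (cnt N d P) (W ^ d) + W * cnt N d P <= W * cnt (N + t) d (thicken N d t P).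
Proof.
move=> d0; apply: leq_trans (leq_mul (leqnn W) (cnt_thicken_shadow N d t P)).
rewrite mulnDr addnC leq_add2l mulnCA leq_mul2l.
by rewrite (shadow_sum_ge N W P d0) orbT.
Qed.

Import Order.TTheory GRing.Theory Num.Theory.
Import numFieldNormedType.Exports.

Local Open Scope classical_set_scope.
Local Open Scope ring_scope.

(** * Hausdorff contents *)

Section euclidean.
Context {R : realType} {n : nat}.
Implicit Types x y z : 'rV[R]_n.

Lemma edist_ge0 x y : 0 <= edist x y.
Proof. exact: sqrtr_ge0. Qed.

Lemma edistC x y : edist x y = edist y x.
Proof. by congr Num.sqrt; apply: eq_bigr => i _; rewrite -sqrrN opprB. Qed.

Lemma edistxx x : edist x x = 0.
Proof. by rewrite /edist big1 ?sqrtr0// => i _; rewrite subrr expr0n. Qed.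

Lemma edist_sqr x y : edist x y ^+ 2 = \sum_(i < n) (x ord0 i - y ord0 i) ^+ 2.
Proof. by rewrite sqr_sqrtr// sumr_ge0// => i _; exact: sqr_ge0. Qed.

Lemma edist_le_sqr x y (r : R) : 0 <= r ->
  (edist x y <= r) = (\sum_(i < n) (x ord0 i - y ord0 i) ^+ 2 <= r ^+ 2).
Proof. by move=> r0; rewrite -edist_sqr ler_sqr// nnegrE edist_ge0. Qed.

Lemma cauchy_schwarz (a b : 'I_n -> R) :
  (\sum_i a i * b i) ^+ 2 <= (\sum_i a i ^+ 2) * (\sum_i b i ^+ 2).
Proof.
have : 0 <= \sum_i \sum_j (a i * b j - a j * b i) ^+ 2.
  by apply: sumr_ge0 => i _; apply: sumr_ge0 => j _; exact: sqr_ge0.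
have -> : \sum_i \sum_j (a i * b j - a j * b i) ^+ 2 =
    2 * ((\sum_i a i ^+ 2) * (\sum_i b i ^+ 2) - (\sum_i a i * b i) ^+ 2).
  set A := \sum_i a i ^+ 2; set B := \sum_i b i ^+ 2; set C := \sum_i a i * b i.
  transitivity (\sum_i (a i ^+ 2 * B + b i ^+ 2 * A + - (2 * (a i * b i)) * C)).
    apply: eq_bigr => i _; rewrite /A /B /C !mulr_sumr -!big_split/=.
    by apply: eq_bigr => j _; ring.
  rewrite !big_split/= -!mulr_suml sumrN -mulr_sumr -/A -/B -/C; ring.
by rewrite pmulr_rge0// subr_ge0.
Qed.

Lemma edist_triangle y x z : edist x z <= edist x y + edist y z.
Proof.
rewrite edist_le_sqr ?addr_ge0 ?edist_ge0//.
set a := fun i => x ord0 i - y ord0 i; set b := fun i => y ord0 i - z ord0 i.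
have -> : \sum_(i < n) (x ord0 i - z ord0 i) ^+ 2 =
    \sum_i a i ^+ 2 + \sum_i b i ^+ 2 + 2 * \sum_i a i * b i.
  rewrite mulr_sumr -!big_split/=; apply: eq_bigr => i _; rewrite /a /b; ring.
have -> : (edist x y + edist y z) ^+ 2 =
    edist x y ^+ 2 + edist y z ^+ 2 + 2 * (edist x y * edist y z) by ring.
rewrite !edist_sqr lerD2l ler_pM2l//.
rewrite (le_trans (ler_norm _))// -ler_sqr ?nnegrE ?mulr_ge0 ?edist_ge0//.
by rewrite real_normK ?num_real// exprMn !edist_sqr cauchy_schwarz.
Qed.

Lemma edist_coord x y i : `|x ord0 i - y ord0 i| <= edist x y.
Proof.
rewrite -ler_sqr ?nnegrE ?edist_ge0// real_normK ?num_real// edist_sqr.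
by rewrite (bigD1 i)//= lerDl sumr_ge0// => j _; exact: sqr_ge0.
Qed.

Lemma edist_coord_le x y (r : R) : 0 <= r ->
  (forall i, `|x ord0 i - y ord0 i| <= r) -> edist x y <= n%:R * r.
Proof.
move=> r0 xyr; rewrite edist_le_sqr ?mulr_ge0//.
apply: (@le_trans _ _ (\sum_(i < n) r ^+ 2)).
  apply: ler_sum => i _; rewrite -(@real_normK _ (_ - _)) ?num_real//.
  by rewrite ler_sqr ?nnegrE.
rewrite sumr_const card_ord exprMn -[leLHS]mulr_natl ler_wpM2r ?sqr_ge0//.
by rewrite -natrX ler_nat -mulnn; case: (n) => // m; exact: leq_pmulr.
Qed.

Lemma edist_affine x y (v : 'rV[R]_n) (a : R) :
  edist (v + a *: x) (v + a *: y) = `|a| * edist x y.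
Proof.
apply/eqP; rewrite -(eqrXn2 (n := 2)) ?mulr_ge0 ?edist_ge0//; apply/eqP.
rewrite exprMn !edist_sqr real_normK ?num_real// mulr_sumr.
by apply: eq_bigr => i _; rewrite !mxE; ring.
Qed.

Lemma diam_ge0 (U : set 'rV[R]_n) : (0 <= diam U)%E.
Proof. by apply: ereal_sup_ubound; left. Qed.

Lemma edist_le_diam (U : set 'rV[R]_n) x y : U x -> U y ->
  ((edist x y)%:E <= diam U)%E.
Proof. by move=> Ux Uy; apply: ereal_sup_ubound; right; exists x, y. Qed.

Lemma diam_le (U : set 'rV[R]_n) (r : \bar R) : (0 <= r)%E ->
  (forall x y, U x -> U y -> (edist x y)%:E <= r)%E -> (diam U <= r)%E.
Proof.
by move=> r0 Ur; apply: ub_ereal_sup => _ [->//|[x [y [Ux Uy ->]]]]; exact: Ur.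
Qed.

End euclidean.

Lemma diam_image_le (R : realType) (m n : nat) (g : 'rV[R]_m -> 'rV[R]_n)
    (U : set 'rV[R]_m) :
  (forall x y, U x -> U y -> edist (g x) (g y) <= edist x y) ->
  (diam (g @` U) <= diam U)%E.
Proof.
move=> g1; apply: diam_le; first exact: diam_ge0.
move=> _ _ [x Ux <-] [y Uy <-]; apply: le_trans (edist_le_diam Ux Uy).
by rewrite lee_fin g1.
Qed.

Lemma lee_expe (R : realDomainType) (d : nat) (a b : \bar R) : (0 <= a)%E -> (a <= b)%E ->
  (a ^+ d <= b ^+ d)%E.
Proof.
move=> a0 ab; elim: d => [|d IHd]; first by rewrite !expe0.
by rewrite !expeS lee_pmul// expe_ge0.
Qed.

Section hausdorff_delta.
Context {R : realType} {n : nat} (d : nat) (delta : R).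
Hypothesis d0 : (0 < d)%N.
Implicit Types (A B : set 'rV[R]_n).
Local Open Scope ereal_scope.

Local Notation Hd := (@hausdorff_delta R n d delta).

Lemma le_hausdorff_delta_set A B : A `<=` B -> Hd A <= Hd B.
Proof.
move=> AB; apply: ereal_inf_le_tmp => _ [U [BU Ud ->]]; exists U; split=> //.
exact: subset_trans BU.
Qed.

Lemma hausdorff_delta_ge0 A : 0 <= Hd A.
Proof.
apply: le_ereal_inf_tmp => _ [U [_ _ ->]]; apply: nneseries_ge0 => i _ _.
exact/expe_ge0/diam_ge0.
Qed.

(* [hausdorff_delta] is the outer measure generated by this set function on
   the discrete measurable space. *)
Let weight (A : set 'rV[R]_n) : \bar R :=
  if diam A <= delta%:E then diam A ^+ d else +oo.

Let T := g_sigma_algebraType [set: set 'rV[R]_n].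

Lemma diam0 : diam (set0 : set 'rV[R]_n) = 0.
Proof. by apply/eqP; rewrite eq_le diam_ge0 diam_le. Qed.

Let weight_ge0 A : 0 <= weight A.
Proof. by rewrite /weight; case: ifP => // _; rewrite expe_ge0// diam_ge0. Qed.

Let hausdorff_deltaE A : Hd A = mu_ext (weight : set T -> _) A.
Proof.
apply/eqP; rewrite eq_le; apply/andP; split; apply: le_ereal_inf_tmp.
  move=> _ [U [mU AU] <-]; have [Ud|/existsNP[i /negP Ui]] :=
      pselect (forall i, diam (U i) <= delta%:E).
    apply: ereal_inf_lbound; exists U; split=> //.
    by apply: eq_eseriesr => i _; rewrite /weight Ud.
  rewrite (@nneseries_pinfty _ _ xpredT i) ?leey// /weight.
  by rewrite (negbTE Ui).
move=> _ [U [AU Ud ->]]; apply: ereal_inf_lbound; exists U.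
  by split=> // i; exact: sub_sigma_algebra.
by apply: eq_eseriesr => i _; rewrite /weight Ud.
Qed.

Lemma hausdorff_delta_bigcup (A : nat -> set 'rV[R]_n) :
  Hd (\bigcup_i A i) <= \sum_(i <oo) Hd (A i).
Proof.
rewrite hausdorff_deltaE; under eq_eseriesr do rewrite hausdorff_deltaE.
exact: mu_ext_sigma_subadditive.
Qed.

Hypothesis delta0 : (0 <= delta)%R.

Lemma hausdorff_delta0 : Hd set0 = 0.
Proof.
rewrite hausdorff_deltaE mu_ext0// /weight diam0 lee_fin delta0.
by case: d d0 => // k _; rewrite expeS mul0e.
Qed.

Lemma hausdorff_delta_seq (T' : eqType) (r : seq T') (F : T' -> set 'rV[R]_n) A :
  (forall x, A x -> exists2 t, t \in r & F t x) ->
  Hd A <= \sum_(t <- r) Hd (F t).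
Proof.
move=> AF; pose G i := if (i < size r)%N then nth set0 (map F r) i else set0.
apply: (@le_trans _ _ (Hd (\bigcup_i G i))).
  apply: le_hausdorff_delta_set => x /AF[t tr Ftx]; exists (index t r) => //.
  by rewrite /G index_mem tr (nth_map t) ?index_mem// nth_index.
apply: (le_trans (hausdorff_delta_bigcup _)).
rewrite (nneseries_split 0 (size r)); last by move=> *; exact: hausdorff_delta_ge0.
rewrite eseries0 ?adde0; last first.
  by move=> k /= + _; rewrite add0n /G ltnNge => ->; exact: hausdorff_delta0.
rewrite add0n -(big_map F xpredT Hd) [leRHS](big_nth set0) size_map.
rewrite [leLHS]big_nat_cond [leRHS]big_nat_cond; apply: lee_sum => i /andP[/andP[_ ir] _].
by rewrite /G ir.
Qed.

Lemma hausdorff_delta_diam A : diam A <= delta%:E -> Hd A <= diam A ^+ d.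
Proof.
move=> Ad; apply: ereal_inf_lbound; exists (fun i => if i == 0%N then A else set0); split.
- by move=> x Ax; exists 0%N.
- by case=> // i; rewrite diam0 lee_fin.
rewrite (nneseries_split 0 1); last by move=> *; rewrite expe_ge0 ?diam_ge0.
rewrite add0n big_nat1 eseries0 ?adde0// => -[|i]// _ _.
by rewrite diam0; case: d d0 => // k _; rewrite expeS mul0e.
Qed.

Lemma hausdorff_delta_cover (T' : eqType) (r : seq T') (F : T' -> set 'rV[R]_n) A (b : R) :
  (0 <= b <= delta)%R ->
  (forall x, A x -> exists2 t, t \in r & F t x) ->
  (forall t x y, t \in r -> F t x -> F t y -> edist x y <= b)%R ->
  Hd A <= ((size r)%:R * b ^+ d)%:E.
Proof.
move=> /andP[b0 bd] AF Fb; apply: (le_trans (hausdorff_delta_seq AF)).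
apply: (@le_trans _ _ (\sum_(t <- r) (b ^+ d)%:E)).
  rewrite big_seq [leRHS]big_seq; apply: lee_sum => t tr.
  have db : diam (F t) <= b%:E.
    by apply: diam_le; rewrite ?lee_fin// => x y Fx Fy; rewrite lee_fin (Fb t).
  rewrite (le_trans (hausdorff_delta_diam _))//.
    by rewrite (le_trans db)// lee_fin.
  by rewrite EFin_expe lee_expe// diam_ge0.
by rewrite sumEFin lee_fin big_const_seq count_predT iter_addr_0 mulr_natl.
Qed.

End hausdorff_delta.

Section hausdorff.
Context {R : realType} (d : nat).
Local Open Scope ereal_scope.
Implicit Types delta : R.

Lemma hausdorff_delta_image (m n : nat) (g : 'rV[R]_m -> 'rV[R]_n) (A : set 'rV[R]_m) delta :
  (forall x y, A x -> A y -> edist (g x) (g y) <= edist x y)%R ->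
  hausdorff_delta d delta (g @` A) <= hausdorff_delta d delta A.
Proof.
move=> g1; apply: le_ereal_inf_tmp => _ [U [AU Ud ->]].
apply: (@le_trans _ _ (\sum_(0 <= i <oo) diam (g @` (U i `&` A)) ^+ d)).
  have gU i : diam (g @` (U i `&` A)) <= diam (U i).
    apply: (@le_trans _ _ (diam (U i `&` A))).
      by apply: diam_image_le => x y [_ Ax] [_ Ay]; exact: g1.
    by apply: diam_le => [|x y [Ux _] [Uy _]]; [exact: diam_ge0|exact: edist_le_diam].
  apply: ereal_inf_lbound; exists (fun i => g @` (U i `&` A)); split=> //.
    by move=> _ [x Ax <-]; have [i _ Uix] := AU _ Ax; exists i => //; exists x.
  by move=> i; apply: le_trans (Ud i).
apply: lee_nneseries => [i _ _|i _]; first by rewrite expe_ge0// diam_ge0.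
rewrite lee_expe ?diam_ge0//; apply: diam_le; first exact: diam_ge0.
move=> _ _ [x [Ux Ax] <-] [y [Uy Ay] <-].
by apply: le_trans (edist_le_diam Ux Uy); rewrite lee_fin g1.
Qed.

Lemma le_hausdorff_delta n (A : set 'rV[R]_n) (a b : R) : (a <= b)%R ->
  hausdorff_delta d b A <= hausdorff_delta d a A.
Proof.
move=> ab; apply: ereal_inf_le_tmp => _ [U [AU Ua ->]]; exists U; split=> // i.
by rewrite (le_trans (Ua i))// lee_fin.
Qed.

(** The contents are nonincreasing in [delta], so their limit from the right at 0 is a supremum. *)
Lemma hausdorffE n (A : set 'rV[R]_n) :
  hausdorff d A = ereal_sup [set hausdorff_delta d delta A | delta in [set x | 0 < x]%R].
Proof.
apply: cvg_lim => //.
have := @nonincreasing_at_right_cvge R (hausdorff_delta d ^~ A) 0%R +oo%O.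
rewrite (_ : [set` _] = [set x | 0 < x]%R).
  by apply=> // x y _ _; exact: le_hausdorff_delta.
by apply/seteqP; split=> x /=; rewrite in_itv/= andbT.
Qed.

Lemma hausdorff_delta_le n (A : set 'rV[R]_n) delta : (0 < delta)%R ->
  hausdorff_delta d delta A <= hausdorff d A.
Proof. by move=> d0; rewrite hausdorffE; apply: ereal_sup_ubound; exists delta. Qed.

Lemma hausdorff_le n (A : set 'rV[R]_n) (M : \bar R) :
  (forall delta, (0 < delta)%R -> hausdorff_delta d delta A <= M) -> hausdorff d A <= M.
Proof. by move=> AM; rewrite hausdorffE; apply: ub_ereal_sup => _ [x x0 <-]; exact: AM. Qed.

Lemma hausdorff_eq0P n (A : set 'rV[R]_n) :
  (forall delta, (0 < delta)%R -> hausdorff_delta d delta A <= 0) <-> hausdorff d A = 0.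
Proof.
split=> [A0|A0 x x0]; last by rewrite -A0 hausdorff_delta_le.
apply/eqP; rewrite eq_le hausdorff_le//=.
by rewrite (le_trans _ (hausdorff_delta_le A ltr01))// hausdorff_delta_ge0.
Qed.

End hausdorff.

(** * The isodiametric inequality *)

Lemma muln_addn_inj q a b a' b' : (b < q)%N -> (b' < q)%N ->
  (q * a + b = q * a' + b')%N -> a = a' /\ b = b'.
Proof.
move=> bq b'q; rewrite !(mulnC q) => e; have q0 : (0 < q)%N by lia.
split.
  by have := congr1 (divn^~ q) e; rewrite !divnMDl// !divn_small// !addn0.
by have := congr1 (modn^~ q) e; rewrite !modnMDl !modn_small.
Qed.

Section lattice_count.
Context {R : realType} {d : nat}.
Implicit Types (r : R) (N p q : nat) (w s : seq nat).

Definition vec w : 'rV[R]_d := \row_i (nth 0%N w i)%:R.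

Definition lattice_ball N r : pred (seq nat) :=
  fun w => edist (vec w) (const_mx N%:R) <= r.

(* The window is translated so that all coordinates are natural numbers. *)
Definition lattice_count r : nat :=
  cnt (Num.truncn r).+1.*2 d (lattice_ball (Num.truncn r).+1 r).

(** The count does not depend on the lattice point taken as centre: translation by [N' - N] moves
    the list into the window of [lattice_count]. *)
Lemma size_le_lattice_count (X : seq (seq nat)) N r : uniq X ->
  (forall w, w \in X -> size w = d /\ lattice_ball N r w) ->
  (size X <= lattice_count r)%N.
Proof.
move=> uX XN; set N' := (Num.truncn r).+1.
pose phi w := mkseq (fun i => nth 0 w i + N' - N)%N d.
have coord w (i : nat) : w \in X -> (i < d)%N ->
    (N < nth 0 w i + N' /\ nth 0 w i < N + N')%N.
  move=> wX id; have [_ wr] := XN w wX.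
  have := le_lt_trans (le_trans (edist_coord (vec w) (const_mx N%:R) (Ordinal id)) wr) (truncnS_gt r).
  by rewrite !mxE/= ltr_norml -/N' -!(ltr_nat R) !natrD; lra.
rewrite /lattice_count cntE -(size_map phi); apply: uniq_leq_size.
  rewrite map_inj_in_uniq// => w v wX vX wv.
  apply: (@eq_from_nth _ 0%N); first by rewrite (XN w wX).1 (XN v vX).1.
  move=> i; rewrite (XN w wX).1 => id; have := congr1 (nth 0%N ^~ i) wv.
  rewrite !nth_mkseq//; have := coord _ _ wX id; have := coord _ _ vX id; lia.
move=> v /mapP[w wX ->]; rewrite mem_filter; apply/andP; split; last first.
  apply/mem_gridP; rewrite size_mkseq; split=> // i id; rewrite nth_mkseq//.
  by have := coord _ _ wX id; lia.
apply: le_trans (XN w wX).2; rewrite le_eqVlt; apply/orP; left; apply/eqP.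
congr Num.sqrt; apply: eq_bigr => i _; rewrite !mxE nth_mkseq//.
by congr (_ ^+ 2); rewrite natrB ?natrD -/N'; [ring|have := coord _ _ wX (ltn_ord i); lia].
Qed.

Lemma le_lattice_count r (s : R) : r <= s -> (lattice_count r <= lattice_count s)%N.
Proof.
move=> rs; rewrite {1}/lattice_count cntE.
apply: (@size_le_lattice_count _ (Num.truncn r).+1); first by rewrite filter_uniq ?grid_uniq.
by move=> w; rewrite mem_filter => /andP[wr /mem_gridP[-> _]]; split=> //; exact: le_trans rs.
Qed.

Lemma lattice_count_gt0 r : 0 <= r -> (0 < lattice_count r)%N.
Proof.
move=> r0; apply: (@leq_trans (size [:: nseq d 0%N])) => //.
apply: (@size_le_lattice_count _ 0) => // w; rewrite inE => /eqP ->.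
rewrite size_nseq; split=> //; rewrite /lattice_ball (_ : vec _ = const_mx 0%:R) ?edistxx//.
by apply/rowP => i; rewrite !mxE nth_nseq if_same.
Qed.

Lemma edist_scale (x y : 'rV[R]_d) (a : R) : edist (a *: x) (a *: y) = `|a| * edist x y.
Proof. by rewrite -(edist_affine x y 0) !add0r. Qed.

Lemma edist_addlK (x y z : 'rV[R]_d) : edist (x - y + z) z = edist x y.
Proof. by congr Num.sqrt; apply: eq_bigr => i _; rewrite !mxE addrK. Qed.

(** Each lattice point [z] of the ball yields the [q ^ d] points [q * z + t] with coordinates of [t]
    below [q], at distance at most [q * d] from [q * z]. *)
Lemma lattice_count_refine q r :
  (q ^ d * lattice_count r <= lattice_count (q%:R * (r + d%:R)))%N.
Proof.
set N := (Num.truncn r).+1.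
pose X := [seq mkseq (fun i => q * nth 0 z i + nth 0 t i)%N d |
  z <- [seq z <- grid N.*2 d | lattice_ball N r z], t <- grid q d].
have -> : (q ^ d * lattice_count r = size X)%N.
  by rewrite /X size_allpairs size_grid mulnC -cntE.
have tq (t : seq nat) i : t \in grid q d -> (i < d)%N -> (nth 0 t i < q)%N.
  by move=> /mem_gridP[_]; exact.
apply: (@size_le_lattice_count _ (q * N)).
  apply: allpairs_uniq; [by rewrite filter_uniq ?grid_uniq|exact: grid_uniq|].
  move=> [z t] [z' t'] /allpairsP[[a b]/= [+ bq [-> ->]]] /allpairsP[[a' b']/= [+ b'q [-> ->]]]/=.
  rewrite !mem_filter => /andP[_ /[dup] aN /mem_gridP[ad _]] /andP[_ /mem_gridP[a'd _]] ab.
  have nab i : (i < d)%N -> nth 0%N a i = nth 0%N a' i /\ nth 0%N b i = nth 0%N b' i.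
    move=> id; have := congr1 (nth 0%N ^~ i) ab; rewrite !nth_mkseq//.
    exact: muln_addn_inj (tq b i bq id) (tq b' i b'q id).
  congr pair.
    by apply: (grid_eq aN) => // i /nab[].
  by apply: (grid_eq bq) => [|i /nab[]//]; have /mem_gridP[] := b'q.
move=> w /allpairsP[[z t]/= [+ tqd ->]]; rewrite mem_filter => /andP[zr zN].
rewrite size_mkseq; split=> //; rewrite /lattice_ball mulrDr addrC.
apply: le_trans (edist_triangle (q%:R *: vec z) _ _) _.
apply: lerD.
  rewrite mulrC; apply: edist_coord_le => // i; rewrite !mxE nth_mkseq// natrD natrM.
  by rewrite addrC addKr normr_nat ler_nat ltnW// tq.
rewrite (_ : const_mx _ = q%:R *: const_mx N%:R); last by apply/rowP => i; rewrite !mxE natrM.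
by rewrite edist_scale normr_nat ler_wpM2l.
Qed.

(** Division with remainder by [p]: the quotients lie in the ball enlarged by [d], and there are
    [p ^ d] remainders. *)
Lemma lattice_count_coarsen p r : (0 < p)%N ->
  (lattice_count (p%:R * r) <= p ^ d * lattice_count (r + d%:R))%N.
Proof.
move=> p0; set N := (Num.truncn (p%:R * r)).+1.
pose Z := [seq z <- grid N.*2 d | lattice_ball N (r + d%:R) z].
(* Adding [(p - 1) * N] moves the centre from [N] to [p * N], whose quotient is [N] again. *)
pose sh (w : seq nat) i := (nth 0 w i + p.-1 * N)%N.
pose phi w := (mkseq (fun i => sh w i %/ p)%N d, mkseq (fun i => sh w i %% p)%N d).
apply: (@leq_trans (size [seq (z, t) | z <- Z, t <- grid p d])); last first.
  rewrite size_allpairs size_grid mulnC leq_mul2l; apply/orP; right.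
  apply: (@size_le_lattice_count _ N); first by rewrite filter_uniq ?grid_uniq.
  by move=> w; rewrite mem_filter => /andP[? /mem_gridP[]].
rewrite /lattice_count -/N cntE -(size_map phi); apply: uniq_leq_size.
  rewrite map_inj_in_uniq ?filter_uniq ?grid_uniq// => w v.
  rewrite !mem_filter => /andP[_ wN] /andP[_ vN] [h1 h2].
  apply: (grid_eq wN) => [|i id]; first by have /mem_gridP[] := vN.
  have := congr1 (nth 0%N ^~ i) h1; have := congr1 (nth 0%N ^~ i) h2; rewrite !nth_mkseq//.
  move=> e1 e2; have : sh w i = sh v i by rewrite (divn_eq (sh w i) p) e1 e2 -divn_eq.
  by rewrite /sh; lia.
move=> zt /mapP[w]; rewrite mem_filter => /andP[wr /mem_gridP[wd wN]] ->.
apply/allpairsP; exists (phi w); split=> //=; last first.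
  by apply/mem_gridP; rewrite size_mkseq; split=> // i id; rewrite nth_mkseq// ltn_mod.
rewrite mem_filter; apply/andP; split; last first.
  apply/mem_gridP; rewrite size_mkseq; split=> // i id; rewrite nth_mkseq// ltn_divLR//.
  by rewrite /sh; have := wN i id; nia.
have pr : 0 < p%:R :> R by rewrite ltr0n.
rewrite /lattice_ball -(ler_pM2l pr) -{1}(ger0_norm (ltW pr)) -edist_scale.
apply: le_trans (edist_triangle (vec (mkseq (sh w) d)) _ _) _.
rewrite mulrDr addrC; apply: lerD; last first.
  rewrite mulrC; apply: edist_coord_le => [|i]; first exact: ltW.
  rewrite !mxE !nth_mkseq// [X in _ - X%:R](divn_eq (sh w i) p) natrD natrM mulrC.
  rewrite opprD addNKr normrN normr_nat ler_nat ltnW// ltn_mod//.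
apply: le_trans wr; rewrite le_eqVlt; apply/orP; left; apply/eqP.
congr Num.sqrt; apply: eq_bigr => i _; rewrite !mxE nth_mkseq// /sh; congr (_ ^+ 2).
rewrite natrD natrM -{2}(prednK p0) -natr1; ring.
Qed.

(** Lattice counts scale like the [d]-th power of the radius, up to an additive error in the radius
    that is negligible on fine grids. This replaces the volume of the ball. *)
Lemma lattice_count_ratio p q r : (0 < p)%N ->
  (q ^ d * lattice_count (p%:R * r) <=
   p ^ d * lattice_count (q%:R * (r + d%:R + d%:R)))%N.
Proof.
move=> p0; apply: leq_trans (leq_mul (leqnn _) (lattice_count_coarsen r p0)) _.
by rewrite mulnCA leq_mul2l lattice_count_refine orbT.
Qed.

(* Brunn-Minkowski applied to the lattice points of [V] and of [- V]: the
   difference set of [V] lies in the ball whose radius is the diameter. *)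
Lemma lattice_isodiametric (V : set 'rV[R]_d) (D : R) (G N : nat) (c : 'rV[R]_d) :
  (0 < G)%N ->
  (forall x y, V x -> V y -> edist x y <= D) ->
  (2 ^ d * cnt N.*2 d (fun w => `[< V (c + G%:R^-1 *: (vec w - const_mx N%:R))%R >])
    <= lattice_count (D * G%:R + d%:R))%N.
Proof.
move=> G0 VD; set P := fun w => `[< _ >].
(* [refl] plays the role of [- V]. As [q = 2 * N - 1 - refl q], both sums allowed by [wpq] are
   within 1 of [p - refl q + 2 * N] in each coordinate, which accounts for the error [d]. *)
pose refl (s : seq nat) := mkseq (fun i => N.*2 - 1 - nth 0 s i)%N d.
pose S := lattice_ball N.*2 (D * G%:R + d%:R).
have reflN (s : seq nat) : s \in grid N.*2 d -> refl s \in grid N.*2 d.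
  move=> /mem_gridP[sd sN]; apply/mem_gridP; rewrite size_mkseq; split=> // i id.
  by rewrite nth_mkseq//; have := sN i id; lia.
have reflK (s : seq nat) : s \in grid N.*2 d -> refl (refl s) = s.
  move=> sN; apply/esym/(grid_eq sN); first by rewrite size_mkseq.
  by move=> i id; rewrite !nth_mkseq//; have /mem_gridP[_ /(_ i id)] := sN; lia.
have PQ : (cnt N.*2 d P <= cnt N.*2 d (fun s => P (refl s)))%N.
  apply: (@cnt_inj _ _ _ _ _ _ refl).
    by move=> s sN Ps; rewrite reflN// reflK.
  by move=> s t /andP[/= sN _] /andP[/= tN _] /(congr1 refl); rewrite !reflK.
apply: (@leq_trans (cnt N.*2.*2 d S)); last first.
  rewrite cntE; apply: (@size_le_lattice_count _ N.*2); first by rewrite filter_uniq ?grid_uniq.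
  by move=> w; rewrite mem_filter => /andP[? /mem_gridP[]].
rewrite -leq_sqr expnMn.
apply: leq_trans (@discrete_brunn_minkowski d N.*2 P (fun s => P (refl s)) S _).
  by rewrite -mulnn leq_mul2l leq_mul2l PQ !orbT.
move=> p q w pN qN wd /asboolP Vp /asboolP Vq wpq.
have Gr : 0 < G%:R :> R by rewrite ltr0n.
have : edist (vec p) (vec (refl q)) <= D * G%:R.
  have := VD _ _ Vp Vq; rewrite edist_affine ger0_norm ?invr_ge0//.
  rewrite [X in X <= _]mulrC ler_pdivrMr// => /(le_trans _); apply.
  rewrite le_eqVlt; apply/orP; left; apply/eqP.
  by congr Num.sqrt; apply: eq_bigr => i _; rewrite !mxE; congr (_ ^+ 2); ring.
rewrite -(edist_addlK _ _ (const_mx (N.*2)%:R)) => pq.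
rewrite /S /lattice_ball addrC.
apply: le_trans (edist_triangle (vec p - vec (refl q) + const_mx (N.*2)%:R) _ _) _.
apply: lerD => //; rewrite -[leRHS]mulr1; apply: edist_coord_le => // i.
rewrite !mxE nth_mkseq//.
have qi : (nth 0 q i <= N.*2 - 1)%N.
  by have /mem_gridP[_ /(_ i (ltn_ord i))] := qN; lia.
have N1 : (1 <= N.*2)%N by have /mem_gridP[_ /(_ i (ltn_ord i))] := qN; lia.
rewrite !natrB//; have [->|->] := wpq i (ltn_ord i).
  by rewrite natrD (_ : _ - _ = -1) ?normrN1//; ring.
by rewrite -addn1 !natrD (_ : _ - _ = 0) ?normr0//; ring.
Qed.

End lattice_count.

Section isodiametric.
Context {R : realType} {d : nat}.

Lemma exprD_le (a t : R) k : 0 <= a -> 0 <= t <= 1 ->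
  (a + t) ^+ k <= a ^+ k + t * (k%:R * (a + 1) ^+ k).
Proof.
move=> a0 /andP[t0 t1]; elim: k => [|k IHk]; first by rewrite !expr0 mul0r mulr0 addr0.
have a1 : 0 <= (a + 1) ^+ k by rewrite exprn_ge0// addr_ge0.
have ak : a ^+ k <= (a + 1) ^+ k.+1.
  apply: (@le_trans _ _ ((a + 1) ^+ k)); first by rewrite lerXn2r ?nnegrE ?lerDl ?addr_ge0.
  by rewrite exprS ler_peMl// lerDr.
rewrite exprSr (le_trans (ler_wpM2r _ IHk)) ?addr_ge0//.
rewrite exprSr -natr1 mulrDl !mulrDr mulrDl mul1r.
have : t * (k%:R * (a + 1) ^+ k) * (a + t) <= t * (k%:R * (a + 1) ^+ k.+1).
  rewrite -mulrA ler_wpM2l// -mulrA ler_wpM2l// exprSr ler_wpM2l// lerD2l//.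
have : a ^+ k * t <= t * (a + 1) ^+ k.+1 by rewrite mulrC ler_wpM2l.
by move: (a ^+ k * a) (a ^+ k * t) => u v; rewrite !mulrDr; lra.
Qed.

Lemma seq_nat_bound (T : eqType) (I : seq T) (f : T -> R) :
  exists G : nat, forall i, i \in I -> f i <= G%:R.
Proof.
elim: I => [|i I [G IH]]; first by exists 0%N.
exists (G + (Num.truncn (f i)).+1)%N => j; rewrite inE natrD => /predU1P[->|/IH jG].
  by rewrite (le_trans (ltW (truncnS_gt _)))// lerDr.
by rewrite (le_trans jG)// lerDl.
Qed.

(** Suppose the sum is too small, and replace the ratios [D i / h] by slightly larger rationals
    [p i / q]. On a fine lattice, [lattice_isodiametric] and [lattice_count_ratio] bound
    [(2 * q) ^ d] times the number of points of [V i] by [p i ^ d] times that of the ball. Summing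
    over the cover gives [(2 * q) ^ d <= \sum p i ^ d], a contradiction. *)
Lemma isodiametric_finite (T : eqType) (I : seq T) (V : T -> set 'rV[R]_d) (D : T -> R)
    (c : 'rV[R]_d) (h : R) : 0 < h ->
  (forall i, 0 <= D i) ->
  (forall i x y, V i x -> V i y -> edist x y <= D i) ->
  (forall y, edist c y <= h -> exists2 i, i \in I & V i y) ->
  (2 * h) ^+ d <= \sum_(i <- I) D i ^+ d.
Proof.
move=> h0 D0 VD cov; rewrite leNgt; apply/negP => lt.
pose a i := D i / h.
have a0 i : 0 <= a i by rewrite divr_ge0// ltW.
have lta : \sum_(i <- I) a i ^+ d < 2 ^+ d.
  rewrite -(ltr_pM2r (exprn_gt0 d h0)) -exprMn mulr_suml.
  apply: le_lt_trans lt; apply: ler_sum => i _.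
  by rewrite -exprMn mulfVK ?gt_eqF.
pose C := \sum_(i <- I) d%:R * (a i + 1) ^+ d.
have C0 : 0 <= C.
  by apply: sumr_ge0 => i _; rewrite mulr_ge0// exprn_ge0// addr_ge0.
set gap := 2 ^+ d - \sum_(i <- I) a i ^+ d.
have gap0 : 0 < gap by rewrite subr_gt0.
(* Replacing each ratio by one at most [1 / q] larger adds at most [C / q] to the sum, less than the
   gap. *)
pose q := (Num.truncn (C / gap)).+1.
have q0 : 0 < q%:R :> R by rewrite ltr0n.
have qC : q%:R^-1 * C < gap.
  by rewrite mulrC ltr_pdivrMr// mulrC -ltr_pdivrMr// truncnS_gt.
have q1 : 0 <= (q%:R^-1 : R) <= 1.
  by rewrite invr_ge0 ltW//= invf_le1// ler1n.
pose p i := (Num.truncn (q%:R * a i)).+1.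
have pq i : (p i)%:R / q%:R <= a i + q%:R^-1.
  rewrite ler_pdivrMr// mulrDl mulVf ?gt_eqF// -natr1 lerD2r mulrC.
  by rewrite truncn_le mulr_ge0// ltW.
have qp i : q%:R * a i < (p i)%:R by exact: truncnS_gt.
have pqsum : \sum_(i <- I) ((p i)%:R / q%:R : R) ^+ d < 2 ^+ d.
  apply: (@le_lt_trans _ _ (\sum_(i <- I) (a i ^+ d + q%:R^-1 * (d%:R * (a i + 1) ^+ d)))).
    apply: ler_sum => i _; apply: le_trans (exprD_le d (a0 i) q1).
    by rewrite lerXn2r ?nnegrE ?divr_ge0 ?addr_ge0 ?(ltW q0)//; case/andP: q1.
  by rewrite big_split/= -mulr_sumr -/C; move: qC; rewrite /gap; lra.
(* On a grid this fine, the margin [p i * h / q - D i] absorbs the additive errors [d] and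
   [2 * d]. *)
have [G1 HG1] := @seq_nat_bound _ I (fun i => (d%:R + (p i)%:R * (d%:R + d%:R)) / ((p i)%:R * (h / q%:R) - D i)).
pose G := G1.+1.
have Gr : 0 < G%:R :> R by rewrite ltr0n.
(* Chosen so that [q * (r' + 2 * d)] is [h * G], the radius of the ball in grid units. *)
pose r' := h * G%:R / q%:R - d%:R - d%:R.
have Gi i : i \in I -> D i * G%:R + d%:R <= (p i)%:R * r'.
  move=> iI; have := HG1 i iI.
  have pos : 0 < (p i)%:R * (h / q%:R) - D i.
    rewrite subr_gt0 mulrCA mulrC -ltr_pdivrMr//.
    by rewrite ltr_pdivlMr// mulrC qp.
  rewrite ler_pdivrMr// => H.
  have : G1%:R * ((p i)%:R * (h / q%:R) - D i) <= G%:R * ((p i)%:R * (h / q%:R) - D i).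
    by rewrite ler_wpM2r ?(ltW pos)// ler_nat.
  rewrite /r' (_ : (p i)%:R * (_ - _) = G%:R * ((p i)%:R * (h / q%:R)) - (p i)%:R * (d%:R + d%:R)).
    by lra.
  by ring.
set N := (Num.truncn (h * G%:R)).+1.
pose P i (w : seq nat) := `[< V i (c + G%:R^-1 *: (vec w - const_mx N%:R)) >].
have cover_le : (lattice_count (d := d) (h * G%:R)%R <= \sum_(i <- I) cnt N.*2 d (P i))%N.
  apply: leq_cnt_union => w wN wh.
  have [|i iI Vi] := cov (c + G%:R^-1 *: (vec w - const_mx N%:R)).
    rewrite -[X in edist X _]addr0 -(scaler0 _ G%:R^-1) edist_affine.
    rewrite ger0_norm ?invr_ge0// mulrC ler_pdivrMr//.
    apply: le_trans wh; rewrite edistC le_eqVlt; apply/orP; left; apply/eqP.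
    by congr Num.sqrt; apply: eq_bigr => j _; rewrite !mxE subr0.
  by exists i => //; apply/asboolP.
have Gcount i : i \in I ->
    (q ^ d * (2 ^ d * cnt N.*2 d (P i)) <= p i ^ d * lattice_count (d := d) (h * G%:R)%R)%N.
  move=> iI.
  have e : h * G%:R = q%:R * (r' + d%:R + d%:R) by rewrite /r'; field; rewrite gt_eqF.
  rewrite [in leqRHS]e.
  apply: leq_trans (@lattice_count_ratio R d (p i) q r' isT).
  rewrite leq_mul2l; apply/orP; right.
  apply: leq_trans (le_lattice_count (Gi i iI)).
  by apply: lattice_isodiametric => // x y; exact: VD.
have : ((q * 2) ^ d * lattice_count (d := d) (h * G%:R)%R <=
    (\sum_(i <- I) p i ^ d) * lattice_count (d := d) (h * G%:R)%R)%N.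
  apply: leq_trans (leq_mul (leqnn _) cover_le) _.
  rewrite expnMn -mulnA big_distrr/= big_distrr/= big_distrl/=.
  by rewrite big_seq [leqRHS]big_seq; apply: leq_sum => i; exact: Gcount.
rewrite leq_pmul2r; last by rewrite lattice_count_gt0// mulr_ge0// ltW.
rewrite -(ler_nat R) natrX natrM exprMn natr_sum => H.
move: pqsum; rewrite ltNge => /negP; apply.
under eq_bigr do rewrite expr_div_n.
rewrite -mulr_suml ler_pdivlMr ?exprn_gt0// mulrC (le_trans H)//.
by rewrite le_eqVlt; apply/orP; left; apply/eqP; apply: eq_bigr => i _; rewrite natrX.
Qed.

End isodiametric.

(** * Hausdorff contents of balls and half balls *)

Section isodiametric_cover.
Context {R : realType} {d : nat}.

Lemma open_edist_nbhd (P : set 'rV[R]_d) :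
  (forall y, P y -> exists2 e : R, 0 < e & forall z, edist y z < e -> P z) -> open P.
Proof.
move=> HP; rewrite openE => y /HP[e e0 He]; rewrite /interior -nbhs_ballE.
exists (e / d.+1%:R) => /=; first by rewrite divr_gt0.
move=> z yz; apply: He; apply: le_lt_trans (edist_coord_le (r := e / d.+1%:R) _ _) _.
- by rewrite divr_ge0// ltW.
- by move=> i; apply: ltW; case: yz => _ yz; exact: (yz ord0 i).
by rewrite mulrA ltr_pdivrMr// mulrC ltr_pM2l// ltr_nat.
Qed.

Lemma compact_closed_eball (c : 'rV[R]_d) (h : R) : compact [set y | edist c y <= h].
Proof.
apply: bounded_closed_compact.
  exists (`|c| + `|h|); split=> [|M cM y /= cy]; first exact: num_real.
  rewrite -(subrK c y) addrC (le_trans (ler_normD _ _))// (le_trans _ (ltW cM))// lerD2l.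
  rewrite /Num.Def.normr/= mx_normrE; apply/bigmax_leP; split=> [|[i j] _ /=]; first exact: normr_ge0.
  rewrite (ord1 i) !mxE distrC (le_trans (edist_coord c y j))//.
  exact: le_trans cy (ler_norm h).
rewrite -openC; apply: open_edist_nbhd => y /= /negP; rewrite -ltNge => hy.
exists (edist c y - h); first by rewrite subr_gt0.
move=> z yz; apply/negP; rewrite -ltNge.
by have := edist_triangle z c y; rewrite (edistC z); lra.
Qed.

(** Compactness reduces to finite covers: the ball is replaced by a smaller closed ball and each
    [U i] by a larger open set. The two losses, [gap / 2] and [gap / 4], stay below the supposed
    gap. *)
Lemma hausdorff_delta_ball (c : 'rV[R]_d) (h delta : R) : 0 < h ->
  (((2 * h) ^+ d)%:E <= hausdorff_delta d delta [set y | (edist c y < h)%R])%E.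
Proof.
move=> h0; apply: le_ereal_inf_tmp => _ [U [cov Ud ->]]; rewrite leNgt; apply/negP => lt.
have dU0 i : (0 <= diam (U i))%E := diam_ge0 _.
have dUfin i : diam (U i) \is a fin_num.
  by rewrite ge0_fin_numE// (le_lt_trans (Ud i))// ltry.
pose D i := fine (diam (U i)).
have D0 i : 0 <= D i by exact: fine_ge0.
have DE i : (diam (U i) ^+ d)%E = (D i ^+ d)%:E by rewrite EFin_expe fineK.
set s := (\sum_(0 <= i <oo) _)%E in lt.
have s0 : (0 <= s)%E by apply: nneseries_ge0 => i _ _; rewrite expe_ge0.
have sfin : s \is a fin_num by rewrite ge0_fin_numE// (lt_trans lt)// ltry.
have [S sS] : exists S, s = S%:E by exists (fine s); rewrite fineK.
rewrite sS lte_fin in lt.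
set gap := (2 * h) ^+ d - S.
have gap0 : 0 < gap by rewrite subr_gt0.
pose C := d%:R * (2 * h + 1) ^+ d.
have C0 : 0 <= C by rewrite mulr_ge0// exprn_ge0// addr_ge0// mulr_ge0// ltW.
pose t := Num.min h (Num.min 1 (gap / 2 / (C + 1))).
have t0 : 0 < t by rewrite !lt_min h0 ltr01 !divr_gt0// ltr_wpDl.
have th : t <= h by rewrite ge_min lexx.
have t1 : t <= 1 by rewrite !ge_min lexx orbT.
have tC : t * C <= gap / 2.
  apply: (@le_trans _ _ (t * (C + 1))); first by rewrite ler_wpM2l ?(ltW t0)// lerDl.
  by rewrite -ler_pdivlMr ?ltr_wpDl// !ge_min lexx !orbT.
pose h' := h - t / 2.
have h'0 : 0 < h' by rewrite /h'; lra.
have h'h : h' < h by rewrite /h'; lra.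
have h'pow : (2 * h) ^+ d <= (2 * h') ^+ d + gap / 2.
  have -> : 2 * h = 2 * h' + t by rewrite /h'; field.
  apply: le_trans (exprD_le d _ _) _; first by lra.
    by rewrite t1 ltW.
  rewrite lerD2l; apply: le_trans tC; rewrite ler_wpM2l ?(ltW t0)//.
  rewrite ler_wpM2l// lerXn2r ?nnegrE ?lerD2r ?ler_pM2l ?(ltW h'h)//; lra.
pose e := gap / 4.
have e0 : 0 < e by rewrite divr_gt0.
pose Ci i := d%:R * (D i + 1) ^+ d.
have Ci0 i : 0 <= Ci i by rewrite mulr_ge0// exprn_ge0// addr_ge0.
(* Enlarging the diameter of [U i] by [ei i] costs at most [e / 2 ^ i.+1], hence at most [e] in
   total. *)
pose ei i := Num.min 1 (e / (2 ^ i.+1)%:R / (Ci i + 1)).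
have p2 i : 0 < (2 ^ i.+1)%:R :> R by rewrite ltr0n expn_gt0.
have ei0 i : 0 < ei i by rewrite lt_min ltr01 !divr_gt0// ltr_wpDl.
have eipow i : (D i + ei i) ^+ d <= D i ^+ d + e / (2 ^ i.+1)%:R.
  apply: le_trans (exprD_le d (D0 i) _) _; first by rewrite ltW//= ge_min lexx.
  rewrite lerD2l -/(Ci i).
  apply: (@le_trans _ _ (ei i * (Ci i + 1))); first by rewrite ler_wpM2l ?(ltW (ei0 i))// lerDl.
  by rewrite -ler_pdivlMr ?ltr_wpDl// ge_min lexx orbT.
pose V i := [set y | exists2 v, U i v & edist y v < ei i / 2].
have oV i : open (V i).
  apply: open_edist_nbhd => y [v Uv yv]; exists (ei i / 2 - edist y v).
    by rewrite subr_gt0.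
  move=> z yz; exists v => //.
  by have := edist_triangle y z v; rewrite (edistC z y); lra.
have : cover_compact [set y | edist c y <= h'].
  rewrite -compact_cover; exact: compact_closed_eball.
move=> /(_ nat setT V)[||F _ Fcov].
- by move=> i _; exact: oV.
- move=> y /= cy; have [|i _ Uy] := cov y; first exact: le_lt_trans h'h.
  by exists i => //; exists y => //; rewrite edistxx divr_gt0.
have lb : (2 * h') ^+ d <= \sum_(i <- F) (D i + ei i) ^+ d.
  apply: (@isodiametric_finite _ _ _ _ V _ c) => //.
  - by move=> i; rewrite addr_ge0// ltW.
  - move=> i x y [u Uu xu] [v Uv yv].
    have : edist u v <= D i by rewrite -lee_fin fineK// edist_le_diam.
    have := edist_triangle u x y; have := edist_triangle v u y.
    by rewrite (edistC v y); lra.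
have ub : ((\sum_(i <- F) (D i + ei i) ^+ d)%:E <= S%:E + e%:E)%E.
  rewrite -sS; apply: (@le_trans _ _ (\sum_(i <oo) (diam (U i) ^+ d + (e / (2 ^ i.+1)%:R)%:E))%E).
    rewrite -sumEFin.
    apply: (@le_trans _ _ (\sum_(i <- F) (diam (U i) ^+ d + (e / (2 ^ i.+1)%:R)%:E))%E).
      by apply: lee_sum => i _; rewrite DE -EFinD lee_fin.
    apply: lee_sum_fset_lim => i _.
    by rewrite adde_ge0 ?expe_ge0// lee_fin divr_ge0// ltW.
  by apply: epsilon_trick => [i|]; rewrite ?expe_ge0// ltW.
move: ub; rewrite -EFinD lee_fin => ub; move: lb ub h'pow gap0; rewrite /e /gap; lra.
Qed.

Definition half_ball (c : 'rV[R]_d) (h : R) (a : 'I_d) (b : bool) : set 'rV[R]_d :=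
  [set y | edist c y < h /\ 0 <= (-1) ^+ b * (y ord0 a - c ord0 a)].

Hypothesis d0 : (0 < d)%N.

(** The ball is covered by the half ball and its mirror image; the reflection is an isometry and the
    content is subadditive. *)
Lemma hausdorff_delta_half_ball (c : 'rV[R]_d) (h delta : R) a b : 0 < h -> 0 < delta ->
  (((2 * h) ^+ d / 2)%:E <= hausdorff_delta d delta (half_ball c h a b))%E.
Proof.
move=> h0 delta0.
pose refl (y : 'rV[R]_d) : 'rV[R]_d :=
  \row_i (if i == a then 2 * c ord0 a - y ord0 a else y ord0 i).
have refl_dist x y : edist (refl x) (refl y) = edist x y.
  congr Num.sqrt; apply: eq_bigr => i _; rewrite !mxE.
  by case: eqP => [->|//]; ring.
have reflK y : refl (refl y) = y.
  by apply/rowP => i; rewrite !mxE eqxx; case: eqP => // ->; ring.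
have reflc : refl c = c.
  by apply/rowP => i; rewrite !mxE; case: eqP => // ->; ring.
set H := half_ball c h a b.
have cov : (hausdorff_delta d delta [set y | (edist c y < h)%R] <=
    hausdorff_delta d delta H + hausdorff_delta d delta H)%E.
  apply: (@le_trans _ _ (\sum_(k <- [:: true; false])
      hausdorff_delta d delta (if k then H else refl @` H))%E).
    apply: hausdorff_delta_seq => //; first exact: ltW.
    move=> y /= cy; have [y0|y0] := leP 0 ((-1) ^+ b * (y ord0 a - c ord0 a)).
      by exists true; rewrite ?inE.
    exists false; rewrite ?inE//; exists (refl y); rewrite ?reflK//; split.
      by rewrite -reflc refl_dist.
    by rewrite mxE eqxx; move: y0; lra.
  rewrite big_cons big_seq1 leeD2l//.
  by apply: hausdorff_delta_image => x y _ _; rewrite refl_dist.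
have := le_trans (hausdorff_delta_ball c delta h0) cov.
have : (0 <= hausdorff_delta d delta H)%E by exact: hausdorff_delta_ge0.
case: (hausdorff_delta d delta H) => [x||]; [|by rewrite !leey|by rewrite leeNy_eq].
by rewrite -EFinD !lee_fin => _; lra.
Qed.

End isodiametric_cover.

(** * The graph *)

(** Nested floors: dividing a fine index by [N] gives the coarse index, so a cell of the fine grid
    lies in one cell of the coarse grid. *)
Lemma truncn_divn (R : realType) (x : R) (N G : nat) : (0 < N)%N ->
  (Num.truncn (x * (N * G)%:R) %/ N)%N = Num.truncn (x * G%:R).
Proof.
move=> N0; have [x0|x0] := leP 0 x; last first.
  have neg (a : nat) : Num.truncn (x * a%:R) = 0%N.
    by apply/truncn0Pn; rewrite -ltNge (le_lt_trans _ ltr01)// mulr_le0_ge0// ltW.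
  by rewrite !neg div0n.
have nn (a : nat) : 0 <= x * a%:R by rewrite mulr_ge0.
apply/esym/truncn_def; have Nr : 0 < N%:R :> R by rewrite ltr0n.
have /andP[l u] := truncn_itv (nn (N * G)%N).
move: l u; set t := Num.truncn _ => l u.
rewrite -(ler_pM2l Nr) -(ltr_pM2l Nr) -!natrM.
have -> : N%:R * (x * G%:R) = x * (N * G)%:R by rewrite natrM; ring.
apply/andP; split.
  by apply: le_trans l; rewrite ler_nat mulnC leq_trunc_div.
apply: (lt_le_trans u); rewrite ler_nat mulnC.
exact: ltn_ceil.
Qed.

Definition binary (d : nat) (b : nat -> bool) : nat := \sum_(i < d) 2 ^ i * b i.

Lemma binaryS d b : binary d.+1 b = (b 0 + (binary d (b \o succn)).*2)%N.
Proof.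
rewrite /binary big_ord_recl expn0 mul1n -mul2n big_distrr/=; congr addn.
by apply: eq_bigr => i _; rewrite expnS mulnA.
Qed.

Lemma binary_lt d b : (binary d b < 2 ^ d)%N.
Proof.
elim: d b => [|d IHd] b; first by rewrite /binary big_ord0.
by rewrite binaryS expnS; have := IHd (b \o succn); case: (b 0%N); lia.
Qed.

Lemma binary_inj d b b' : binary d b = binary d b' ->
  forall i, (i < d)%N -> b i = b' i.
Proof.
elim: d b b' => // d IHd b b'; rewrite !binaryS => e.
have e0 : b 0%N = b' 0%N.
  by have := congr1 odd e; rewrite !oddD !odd_double !addbF; case: (b 0%N); case: (b' 0%N).
have eS : binary d (b \o succn) = binary d (b' \o succn).
  by move: e; rewrite e0 => /addnI /double_inj.
by case=> // i; rewrite ltnS => /(IHd _ _ eS).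
Qed.

Section digits.
Context {R : realType} {d : nat}.
Implicit Types (x y : 'rV[R]_d) (G : nat).

(** Index of the cell of side [1 / G] containing [x]. [Num.truncn] is the floor only on nonnegative
    reals, hence the domains [nonneg_below]. *)
Definition idx G x : seq nat := [seq Num.truncn (x ord0 i * G%:R) | i <- enum 'I_d].

Lemma size_idx G x : size (idx G x) = d.
Proof. by rewrite size_map size_enum_ord. Qed.

Lemma nth_idx G x (i : 'I_d) : nth 0%N (idx G x) i = Num.truncn (x ord0 i * G%:R).
Proof. by rewrite (nth_map i) ?size_enum_ord// nth_ord_enum. Qed.

Lemma idxP G x y :
  (forall i, Num.truncn (x ord0 i * G%:R) = Num.truncn (y ord0 i * G%:R)) <->
  idx G x = idx G y.
Proof.
split=> [xy|xy i]; last by rewrite -!nth_idx xy.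
by apply: eq_map => i; exact: xy.
Qed.

Lemma idx_refine G G' x y : (0 < G')%N -> (G %| G')%N ->
  idx G' x = idx G' y -> idx G x = idx G y.
Proof.
move=> G'0 /dvdnP[N GN] /idxP xy; apply/idxP => i.
have N0 : (0 < N)%N by rewrite GN muln_gt0 in G'0; case/andP: G'0.
by rewrite -(truncn_divn (x ord0 i) G N0) -(truncn_divn (y ord0 i) G N0) -GN xy.
Qed.

Definition nonneg_below (m : R) : set 'rV[R]_d := [set x | forall i, 0 <= x ord0 i < m].

Lemma idx_grid G (m : nat) x : (0 < G)%N -> nonneg_below m%:R x -> idx G x \in grid (m * G) d.
Proof.
move=> G0 xm; apply/mem_gridP; rewrite size_idx; split=> // i id.
rewrite (nth_idx G x (Ordinal id)); have /andP[x0 x1] := xm (Ordinal id).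
rewrite truncn_lt_nat ?mulr_ge0// natrM ltr_pM2r// ltr0n//.
Qed.

Lemma truncn_dist (a b : R) : 0 <= a -> 0 <= b -> Num.truncn a = Num.truncn b ->
  `|a - b| <= 1.
Proof.
move=> /truncn_itv + /truncn_itv + ab; rewrite ab -natr1 ler_norml; lra.
Qed.

Lemma idx_edist G m x y : (0 < G)%N -> nonneg_below m x -> nonneg_below m y ->
  idx G x = idx G y -> edist x y <= d%:R / G%:R.
Proof.
move=> G0 xm ym /idxP xy; apply: edist_coord_le; first by rewrite invr_ge0.
have Gr : 0 < G%:R :> R by rewrite ltr0n.
move=> i; have /andP[x0 _] := xm i; have /andP[y0 _] := ym i.
rewrite -[leRHS]mul1r ler_pdivlMr// -{1}(ger0_norm (ltW Gr)) -normrM mulrBl.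
by apply: truncn_dist (xy i); rewrite mulr_ge0// ltW.
Qed.

End digits.

(** * The scales of the construction *)

Section scales.
Context (R : realType) (d : nat).

(* The factor [2 ^ d.+2] makes the jumps of all levels after [k] add up to at
   most a quarter of the jump at level [k]. *)
Definition branching : nat := locked (2 ^ d.+2)%N.
Local Notation c := branching.

(** A cell side of level [k] is divided into [c * (k + 1)] parts. The factor [k + 1] makes the
    corner sets summable and the growth sum harmonic. *)
Definition mesh (k : nat) : nat := locked (c ^ k * k`!)%N.
Local Notation L := mesh.

(** The length of [c] cell sides of level [k + 1], which is the fraction [1 / (k + 1)] of a cell
    side of level [k]. *)
Definition jump (k : nat) : R := c%:R / (L k.+1)%:R.
Local Notation tau := jump.

Lemma branching_gt0 : (0 < c)%N. Proof. by rewrite /branching -lock expn_gt0. Qed.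
Local Hint Resolve branching_gt0 : core.

Lemma branchingE : c%:R = 4 * 2 ^+ d :> R.
Proof. by rewrite /branching -lock natrX !exprS; ring. Qed.

Lemma mesh_gt0 k : (0 < L k)%N.
Proof. by rewrite /mesh -lock muln_gt0 expn_gt0 fact_gt0 branching_gt0. Qed.
Local Hint Resolve mesh_gt0 : core.

Lemma mesh_gtr0 k : 0 < (L k)%:R :> R. Proof. by rewrite ltr0n. Qed.
Local Hint Resolve mesh_gtr0 : core.

Lemma meshS k : L k.+1 = (c * k.+1 * L k)%N.
Proof. by rewrite /mesh -!lock expnS factS; lia. Qed.

Lemma dvdn_mesh j k : (j <= k)%N -> (L j %| L k)%N.
Proof.
elim: k => [|k IHk]; first by rewrite leqn0 => /eqP ->.
by rewrite leq_eqVlt ltnS => /predU1P[->//|/IHk jk]; rewrite meshS dvdn_mull.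
Qed.

Lemma ltn_mesh k : (k < L k)%N.
Proof.
have c1 : (1 < c)%N by rewrite /branching -lock -[1%N](expn0 2) ltn_exp2l.
by apply: leq_trans (ltn_expl k c1) _; rewrite /mesh -lock leq_pmulr// fact_gt0.
Qed.

Lemma jump_gt0 k : 0 < tau k.
Proof. by rewrite divr_gt0// ltr0n. Qed.

Lemma jump_ge0 k : 0 <= tau k. Proof. exact/ltW/jump_gt0. Qed.

Lemma jumpE k : tau k = ((L k)%:R * k.+1%:R)^-1.
Proof.
have c0 : c%:R != 0 :> R by rewrite pnatr_eq0 -lt0n.
rewrite /jump meshS; have l0 : (L k)%:R != 0 :> R by rewrite pnatr_eq0 -lt0n mesh_gt0.
move: c (L k) c0 l0 => b l b0 l0; rewrite !natrM; field.
by rewrite b0 l0 addrC natr1 pnatr_eq0.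
Qed.

Lemma jump_mesh k : tau k <= (L k)%:R^-1.
Proof.
rewrite jumpE lef_pV2 ?posrE ?mulr_gt0//.
by rewrite ler_peMr// ler1n.
Qed.

(** The ratio of consecutive jumps is [c * (k + 2)], at least [2 * c = 8 * 2 ^ d]. *)
Lemma jumpS k : 8 * 2 ^+ d * tau k.+1 <= tau k.
Proof.
have -> : tau k.+1 = tau k / (c * k.+2)%:R.
  by rewrite /jump (meshS k.+1) natrM invfM mulrA mulrAC.
rewrite natrM branchingE mulrA ler_pdivrMr; last by rewrite !mulr_gt0 ?exprn_gt0.
rewrite [leRHS]mulrC ler_wpM2r ?jump_ge0//.
have : 2 <= k.+2%:R :> R by rewrite ler_nat.
have : 0 < 2 ^+ d :> R by rewrite exprn_gt0.
nra.
Qed.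

Lemma jump_half k : 2 * tau k.+1 <= tau k.
Proof.
apply: le_trans (jumpS k); rewrite ler_wpM2r ?jump_ge0//.
have : 1 <= 2 ^+ d :> R by rewrite exprn_ege1// ler1n.
lra.
Qed.

Lemma le_jump j k : (j <= k)%N -> tau k <= tau j.
Proof.
elim: k => [|k IHk]; first by rewrite leqn0 => /eqP ->.
rewrite leq_eqVlt ltnS => /predU1P[->//|/IHk]; apply: le_trans.
by have := jump_half k; have := jump_gt0 k.+1; lra.
Qed.

End scales.
#[global] Hint Resolve branching_gt0 mesh_gt0 : core.

Section height.
Context {R : realType} {d : nat}.
Implicit Types (x y : 'rV[R]_d).
Local Notation L := (mesh d).
Local Notation tau := (jump R d).
Local Notation tail k := (2 ^+ d.+1 * tau k).

(** The parities of the index, read in binary. Distinct indices that differ by at most one in each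
    coordinate differ in some parity, hence in the code. *)
Definition corner_code (k : nat) x : nat := binary d (fun i => odd (nth 0%N (idx (L k) x) i)).

Definition height_upto (k : nat) x : R := \sum_(j < k) tau j * (corner_code j x)%:R.

(** The partial sums are nondecreasing and bounded, so the supremum is the sum of the series. *)
Definition height x : R := sup (range (height_upto ^~ x)).

Lemma height_uptoS k x : height_upto k.+1 x = height_upto k x + tau k * (corner_code k x)%:R.
Proof. by rewrite /height_upto big_ord_recr. Qed.

Lemma corner_code_le k x : (corner_code k x)%:R <= 2 ^+ d :> R.
Proof. by rewrite -natrX ler_nat ltnW// binary_lt. Qed.

Lemma height_upto_le m k x : height_upto m x <= height_upto k x + tail k.
Proof.
have [mk|/ltnW km] := leqP m k.
  apply: (@le_trans _ _ (height_upto k x)).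
    elim: k mk => [|k IHk]; first by rewrite leqn0 => /eqP ->.
    rewrite leq_eqVlt ltnS => /predU1P[->//|/IHk]/le_trans; apply.
    by rewrite height_uptoS lerDl mulr_ge0// jump_ge0.
  by rewrite lerDl mulr_ge0 ?exprn_ge0// jump_ge0.
rewrite -(subnKC km); set p := (m - k)%N.
(* Strengthened for the induction: a term of level [j] is at most [2 ^ d * jump j], which is at most
   [tail j - tail (j + 1)]. *)
apply: (@le_trans _ _ (height_upto k x + tail k - tail (k + p))); last first.
  by rewrite gerBl mulr_ge0 ?exprn_ge0// jump_ge0.
elim: p => [|p IHp]; first by rewrite addn0; lra.
rewrite addnS height_uptoS (le_trans (lerD IHp (ler_wpM2l _ (corner_code_le _ _))))//.
  exact: jump_ge0.
have := jump_half R d (k + p); have : 0 <= 2 ^+ d :> R by rewrite exprn_ge0.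
rewrite exprS; move: (2 ^+ d) (tau _) (tau _) => D t t'; nra.
Qed.

Lemma height_bound k x :
  height_upto k x <= height x <= height_upto k x + tail k.
Proof.
apply/andP; split.
  apply: ub_le_sup; last by exists k.
  by exists (height_upto 0 x + tail 0) => _ [m _ <-]; exact: height_upto_le.
apply: ge_sup; first by exists (height_upto 0 x), 0%N.
by move=> _ [m _ <-]; exact: height_upto_le.
Qed.

Lemma idx_mesh_le j k x y : (j <= k)%N -> idx (L k) x = idx (L k) y -> idx (L j) x = idx (L j) y.
Proof. by move=> jk; apply: idx_refine => //; exact: dvdn_mesh. Qed.

Lemma height_upto_eq k x y : (forall j, (j < k)%N -> idx (L j) x = idx (L j) y) ->
  height_upto k x = height_upto k y.
Proof.
by move=> xy; apply: eq_bigr => j _; rewrite /corner_code xy.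
Qed.

Lemma height_close k x y : idx (L k) x = idx (L k) y -> `|height x - height y| <= tail k.+1.
Proof.
move=> xy; have e : height_upto k.+1 x = height_upto k.+1 y.
  by apply: height_upto_eq => j; rewrite ltnS => jk; exact: idx_mesh_le xy.
have := height_bound k.+1 x; have := height_bound k.+1 y; rewrite e ler_norml; lra.
Qed.

(* At the coarsest level where the cells of [x] and [y] differ, either some
   coordinates are a mesh size apart or the codes differ, and later levels are
   too small to compensate that jump. *)
Lemma height_separated m k x y : nonneg_below m x -> nonneg_below m y ->
  idx (L k) x <> idx (L k) y ->
  (exists i, tau k / 2 <= `|x ord0 i - y ord0 i|) \/ tau k / 2 <= `|height x - height y|.
Proof.
move=> xm ym kxy.
have exj : exists j, idx (L j) x != idx (L j) y by exists k; exact/eqP.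
case: (ex_minnP exj) => j /eqP jxy jmin.
have jk : (j <= k)%N by apply: jmin; exact/eqP.
have tkj := le_jump R d jk; have tk0 := jump_gt0 R d k.
have [[i ij]|/forallNP near] := pselect (exists i, (L j)%:R^-1 <= `|x ord0 i - y ord0 i|).
  by left; exists i; have := jump_mesh R d j; lra.
right; apply: (@le_trans _ _ (tau j / 2)); first by lra.
have e : height_upto j x = height_upto j y.
  apply: height_upto_eq => i ij; apply/eqP; apply: contraLR ij => /jmin.
  by rewrite -leqNgt.
have Lj : 0 < (L j)%:R :> R by exact: mesh_gtr0.
(* The coordinates differ by less than a cell side, so the indices differ by at most one; equal
   parities would make them equal. *)
have code : corner_code j x <> corner_code j y.
  move=> /binary_inj par; apply: jxy; apply/idxP => i.
  have /negP := near i; rewrite -ltNge => lti.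
  have := par i (ltn_ord i); rewrite !nth_idx.
  have /andP[x0 _] := xm i; have /andP[y0 _] := ym i.
  have := truncn_itv (mulr_ge0 x0 (ltW Lj)); have := truncn_itv (mulr_ge0 y0 (ltW Lj)).
  move: (Num.truncn _) (Num.truncn _) => a b ha hb ab.
  have : `|x ord0 i * (L j)%:R - y ord0 i * (L j)%:R| < 1.
    by rewrite -mulrBl normrM (ger0_norm (ltW Lj)) -ltr_pdivlMr// mul1r.
  rewrite ltr_norml => near1.
  have b2 : (b < a + 2)%N by rewrite -(ltr_nat R) natrD; move: ha hb near1; rewrite -!natr1; lra.
  have a2 : (a < b + 2)%N by rewrite -(ltr_nat R) natrD; move: ha hb near1; rewrite -!natr1; lra.
  by move: ab b2 a2; clear; lia.
have diff : tau j <= `|tau j * (corner_code j x)%:R - tau j * (corner_code j y)%:R|.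
  rewrite -mulrBr normrM (ger0_norm (ltW (jump_gt0 R d j))) ler_peMr ?jump_ge0//.
  have /orP[lt|lt] : (corner_code j x < corner_code j y)%N || (corner_code j y < corner_code j x)%N.
    by rewrite -neq_ltn; exact/eqP.
    by rewrite distrC -natrB ?(ltnW lt)// normr_nat ler1n subn_gt0.
  by rewrite -natrB ?(ltnW lt)// normr_nat ler1n subn_gt0.
have := height_bound j.+1 x; have := height_bound j.+1 y; rewrite !height_uptoS e.
have : 2 * tail j.+1 <= tau j / 2.
  have := jumpS R d j; rewrite exprS; move: (2 ^+ d) (tau _) (tau _) => *; nra.
move: diff; set a := tau j * _; set b := tau j * _; move: (tail _) => t diff tt hy hx.
rewrite ler_normr; have [ab|ab] := leP 0 (a - b).
  by apply/orP; left; move: diff; rewrite ger0_norm//; move: hx hy tt; lra.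
by apply/orP; right; move: diff; rewrite ltr0_norm//; move: hx hy tt; lra.
Qed.

End height.

Section graph.
Context {R : realType} {d n : nat} (dn : (d < n)%N).
Local Notation L := (mesh d).
Local Notation tau := (jump R d).
Local Notation tail k := (2 ^+ d.+1 * tau k).

(** The height is placed in coordinate [d] and all later coordinates are 0, so one construction
    serves every codimension. *)
Definition graph (x : 'rV[R]_d) : 'rV[R]_n :=
  \row_(j < n) (if insub (j : nat) is Some i then x ord0 (i : 'I_d)
                else if j == d :> nat then height x else 0).

Definition proj (y : 'rV[R]_n) : 'rV[R]_d := \row_(i < d) y ord0 (widen_ord (ltnW dn) i).

Definition graph_set : set 'rV[R]_n := graph @` nonneg_below 1.

Lemma graphK x : proj (graph x) = x.
Proof. by apply/rowP => i; rewrite !mxE /= valK. Qed.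

Lemma proj_dist x y : edist (proj x) (proj y) <= edist x y.
Proof.
rewrite edist_le_sqr ?edist_ge0// edist_sqr (bigID (fun j : 'I_n => (j < d)%N))/=.
rewrite -[leLHS]addr0; apply: lerD; last by apply: sumr_ge0 => j _; exact: sqr_ge0.
rewrite (big_ord_narrow (ltnW dn)) le_eqVlt; apply/orP; left; apply/eqP.
by apply: eq_bigr => i _; rewrite !mxE.
Qed.

Lemma graph_dist_sqr x y :
  edist (graph x) (graph y) ^+ 2 = edist x y ^+ 2 + (height x - height y) ^+ 2.
Proof.
rewrite !edist_sqr (bigID (fun j : 'I_n => (j < d)%N))/=; congr (_ + _).
  rewrite (big_ord_narrow (ltnW dn)).
  by apply: eq_bigr => i _; rewrite !mxE /= valK.
rewrite (bigD1 (Ordinal dn)) ?ltnn//= big1 ?addr0; last first.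
  move=> j /andP[jd /eqP jn]; rewrite !mxE !insubF ?(negbTE jd)//.
  case: eqP => [e|]; last by rewrite subrr expr0n.
  by exfalso; apply: jn; exact: val_inj.
by rewrite !mxE /= !insubF ?ltnn// eqxx.
Qed.

Lemma edist_le_graph x y : edist x y <= edist (graph x) (graph y).
Proof. by rewrite -{1}(graphK x) -{1}(graphK y) proj_dist. Qed.

Lemma height_le_graph x y : `|height x - height y| <= edist (graph x) (graph y).
Proof.
rewrite -ler_sqr ?nnegrE ?edist_ge0// real_normK ?num_real// graph_dist_sqr.
by rewrite lerDr sqr_ge0.
Qed.

Lemma graph_le x y : edist (graph x) (graph y) <= edist x y + `|height x - height y|.
Proof.
rewrite -ler_sqr ?nnegrE ?addr_ge0 ?edist_ge0// graph_dist_sqr.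
rewrite -(@real_normK _ (height x - height y)) ?num_real//.
have := mulr_ge0 (edist_ge0 x y) (normr_ge0 (height x - height y)); nra.
Qed.

Lemma graph_separated m k x y : nonneg_below m x -> nonneg_below m y ->
  idx (L k) x <> idx (L k) y -> tau k / 2 <= edist (graph x) (graph y).
Proof.
move=> xm ym xy; have [[i xyi]|h] := height_separated xm ym xy.
  exact: le_trans xyi (le_trans (edist_coord _ _ _) (edist_le_graph _ _)).
exact: le_trans h (height_le_graph _ _).
Qed.

Lemma tail_mesh k : tail k.+1 <= (L k)%:R^-1.
Proof.
have := jumpS R d k; have := jump_mesh R d k; have := jump_ge0 R d k.+1.
have : 0 < 2 ^+ d :> R by rewrite exprn_gt0.
rewrite exprS; nra.
Qed.

Lemma graph_cell_diam m k x y : nonneg_below m x -> nonneg_below m y ->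
  idx (L k) x = idx (L k) y -> edist (graph x) (graph y) <= d.+1%:R / (L k)%:R.
Proof.
move=> xm ym xy; rewrite (le_trans (graph_le _ _))// -natr1 mulrDl mul1r.
apply: lerD; first exact: (idx_edist _ xm ym).
exact: le_trans (height_close xy) (tail_mesh k).
Qed.

Hypothesis d0 : (0 < d)%N.

Lemma hausdorff_delta_cells (delta : R) (k : nat) (S : seq (seq nat)) (A : set 'rV[R]_d) :
  d.+1%:R / (L k)%:R <= delta -> A `<=` nonneg_below 1 ->
  (forall x, A x -> idx (L k) x \in S) ->
  (hausdorff_delta d delta (graph @` A) <= ((size S)%:R * (d.+1%:R / (L k)%:R) ^+ d)%:E)%E.
Proof.
move=> Ldelta A1 AS.
have db : 0 <= (d.+1%:R / (L k)%:R : R) <= delta by rewrite divr_ge0.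
pose F u := graph @` [set x | A x /\ idx (L k) x = u].
have delta0 : 0 <= delta by case/andP: db => + _; move=> /le_trans; apply.
apply: (@hausdorff_delta_cover _ _ _ _ d0 delta0 _ S F) => //.
- by move=> _ [x Ax <-]; exists (idx (L k) x); [exact: AS|exists x].
move=> u _ _ _ [x [Ax xu] <-] [y [Ay yu] <-].
by apply: (graph_cell_diam (A1 _ Ax) (A1 _ Ay)); rewrite xu yu.
Qed.

Lemma mesh_small (C delta : R) : 0 < delta -> exists K, forall k, (K <= k)%N -> C / (L k)%:R <= delta.
Proof.
move=> delta0; exists (Num.truncn (C / delta)).+1 => k Kk.
rewrite ler_pdivrMr ?mesh_gtr0// mulrC -ler_pdivrMr// ltW//.
rewrite (lt_le_trans (truncnS_gt _))// ler_nat (leq_trans Kk)// ltnW//.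
exact: ltn_mesh.
Qed.

(** The [mesh K ^ d] cells of the cube lift to pieces of diameter at most [(d + 1) / mesh K], so the
    mesh cancels. *)
Lemma hausdorff_graph_set_le : (hausdorff d graph_set <= (d.+1%:R ^+ d)%:E)%E.
Proof.
apply: hausdorff_le => delta delta0.
have [K /(_ K (leqnn K)) HK] := mesh_small d.+1%:R delta0.
apply: le_trans (hausdorff_delta_cells (S := grid (L K) d) HK _ _) _ => //.
  by move=> x x1; have := @idx_grid R d (L K) 1 x (mesh_gt0 d K) x1; rewrite mul1n.
rewrite lee_fin size_grid natrX -exprMn mulrCA divff ?mulr1//.
by rewrite pnatr_eq0 -lt0n.
Qed.

(** The projection is 1-Lipschitz and maps the graph onto a set containing a ball of radius 1/2. *)
Lemma hausdorff_graph_set_gt0 : (0 < hausdorff d graph_set)%E.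
Proof.
apply: lt_le_trans (hausdorff_delta_le d graph_set ltr01).
have pr : (hausdorff_delta d 1 (proj @` graph_set) <= hausdorff_delta d 1 graph_set)%E.
  by apply: hausdorff_delta_image => x y _ _; exact: proj_dist.
apply: lt_le_trans pr.
apply: (@lt_le_trans _ _ (((2 * 2^-1 : R) ^+ d)%:E)); first by rewrite lte_fin exprn_gt0// mulfV.
apply: le_trans (@hausdorff_delta_ball R d (const_mx 2^-1) 2^-1 1 _) _; first by rewrite invr_gt0.
apply: le_hausdorff_delta_set => x /= xb; exists (graph x); last exact: graphK.
exists x => // i; have := le_lt_trans (edist_coord _ _ i) xb.
by rewrite mxE ltr_norml; lra.
Qed.

(** Equality of coordinate [d] with the height amounts to bounds, for all [k], between 0 and
    [tail k] on its excess over [height_upto k]; partial heights are finite combinations of Borel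
    indicators. *)
Lemma borel_graph_set : borel_set graph_set.
Proof.
pose T := g_sigma_algebraType [set U : set 'rV[R]_n | open U].
have mcoord (j : 'I_n) : measurable_fun setT (fun y : T => (y : 'rV[R]_n) ord0 j).
  apply: (measurability _ (RGenOInfty.measurableE R)) => // _ [_ [a ->] <-].
  rewrite setTI; apply: sub_sigma_algebra => /=; apply: open_edist_nbhd => y.
  rewrite /= in_itv/= andbT => ay; exists (y ord0 j - a); first by rewrite subr_gt0.
  move=> z yz; rewrite /= in_itv/= andbT.
  by have := le_lt_trans (edist_coord y z j) yz; rewrite ltr_norml; lra.
have mpre (f : T -> R) (A : set R) : measurable_fun setT f -> measurable A ->
    measurable (f @^-1` A).
  by move=> mf mA; rewrite -[X in measurable X]setTI; exact: mf.
have modd (G : nat) (i : 'I_d) :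
    measurable [set y : T | odd (Num.truncn (proj y ord0 i * G%:R))].
  (* The truncation is odd exactly on these intervals; negative reals truncate to 0, which is
     even. *)
  pose A (m : nat) := `[(m.*2.+1)%:R : R, (m.*2.+2)%:R[%classic.
  pose f (y : T) : R := (y : 'rV[R]_n) ord0 (widen_ord (ltnW dn) i) * G%:R.
  rewrite (_ : [set _ | _] = \bigcup_m (f @^-1` A m)).
    apply: bigcupT_measurable => m; apply: mpre; last exact: measurable_itv.
    by apply: measurable_funM => //; exact: mcoord.
  apply/seteqP; split=> y; rewrite /= mxE -/(f y).
    move=> ody; exists (Num.truncn (f y))./2 => //; rewrite /= /A /= in_itv/=.
    have f1 : 1 <= f y by rewrite -truncn_gt0; case: Num.truncn ody.
    have := truncn_itv (le_trans ler01 f1).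
    by rewrite -[in X in X -> _](odd_double_half (Num.truncn (f y))) ody add1n.
  by move=> [m _]; rewrite /= /A /= in_itv/= => /truncn_def ->; rewrite /= odd_double.
have mcode k : measurable_fun setT (fun y : T => (corner_code k (proj y))%:R : R).
  rewrite (_ : (fun y : T => _) = fun y : T => \sum_(i < d) (2 ^ i)%:R *
      (odd (nth 0%N (idx (L k) (proj y)) i))%:R); last first.
    apply/funext => y; rewrite /corner_code /binary natr_sum.
    by apply: eq_bigr => i _; rewrite natrM.
  apply: measurable_sum => i.
  apply: measurable_funM => //.
  rewrite (_ : (fun _ => _) = \1_[set y : T | odd (Num.truncn (proj y ord0 i * (L k)%:R))]).
    exact: measurable_indic.
  apply/funext => y; rewrite indicE nth_idx; congr (nat_of_bool _)%:R.
  by apply/idP/idP => [h|/set_mem//]; exact/mem_set.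
have mupto k : measurable_fun setT (fun y : T => height_upto k (proj y)).
  by apply: measurable_sum => j; apply: measurable_funM => //; exact: mcode.
rewrite (_ : graph_set =
  (\bigcap_(i in [set: 'I_d]) ((fun y : T => (y : 'rV[R]_n) ord0 (widen_ord (ltnW dn) i)) @^-1` `[0, 1[)) `&`
  (\bigcap_k ((fun y : T => (y : 'rV[R]_n) ord0 (Ordinal dn) - height_upto k (proj y)) @^-1` `[0, tail k])) `&`
  (\bigcap_(j in [set j : 'I_n | (d < j)%N]) ((fun y : T => (y : 'rV[R]_n) ord0 j) @^-1` [set 0]))).
  have : (measurable : set (set T)) `<=` borel_set (n := n) by [].
  apply; apply: measurableI; first apply: measurableI.
  - apply: fin_bigcap_measurable => [|i _]; first exact: finite_finset.
    by apply: mpre; [exact: mcoord|exact: measurable_itv].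
  - apply: bigcapT_measurable => k; apply: mpre; last exact: measurable_itv.
    by apply: measurable_funB; [exact: mcoord|exact: mupto].
  - apply: fin_bigcap_measurable => [|i _]; first exact: finite_finset.
    by apply: mpre; [exact: mcoord|exact: measurable_set1].
apply/seteqP; split=> [_ [x x1 <-]|y [[y01 yh] y0]].
  split; first split.
  - by move=> i _ /=; rewrite in_itv/= mxE /= valK; exact: x1.
  - move=> k _ /=; rewrite graphK in_itv/= mxE /= insubF ?ltnn// eqxx.
    by have := height_bound k x; lra.
  - by move=> j /= dj; rewrite mxE insubF ?(gtn_eqF dj)// ltnNge ltnW.
have hy : y ord0 (Ordinal dn) = height (proj y).
  apply/eqP; rewrite -subr_eq0 -normr_le0; apply/ler_addgt0Pr => e e0; rewrite add0r.
  have [K /(_ K (leqnn K)) HK] := mesh_small (2 ^+ d.+1) e0.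
  apply: le_trans HK; apply: (@le_trans _ _ (tail K)).
    have := height_bound K (proj y); have /= := yh K I.
    by rewrite in_itv/= ler_norml; lra.
  by rewrite ler_wpM2l ?exprn_ge0// jump_mesh.
exists (proj y).
  by move=> i; have /= := y01 i I; rewrite in_itv/= mxE.
apply/rowP => j; rewrite mxE; case: insubP => [i jd ij|].
  by rewrite mxE; congr (y _ _); apply: val_inj; rewrite /= ij.
rewrite -leqNgt leq_eqVlt => /predU1P[dj|dj].
  by rewrite -dj eqxx -hy; congr (y _ _); exact: val_inj.
by rewrite (gtn_eqF dj); apply/esym/y0.
Qed.

Lemma d_set_graph_set : d_set d graph_set.
Proof.
split; [exact: borel_graph_set|exact: hausdorff_graph_set_gt0|].
by rewrite (le_lt_trans hausdorff_graph_set_le)// ltry.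
Qed.

End graph.

(** * Lower density *)

Lemma cnt_box B d (P : nat -> pred nat) :
  cnt B d (fun s => all (fun i => P i (nth 0%N s i)) (iota 0 d)) =
  (\prod_(i < d) \sum_(a < B) P i a)%N.
Proof.
elim: d P => [|d IHd] P; first by rewrite cnt0 big_ord0.
rewrite cntS big_ord_recl -(IHd (fun i => P i.+1)) big_distrl/=.
apply: eq_bigr => a _; case Pa : (P 0%N a) => /=.
  rewrite mul1n; apply: eq_bigr => s _; congr nat_of_bool.
  by rewrite -[1%N]/(1 + 0)%N iotaDl all_map.
by rewrite mul0n; apply: big1.
Qed.

(** Conditions on two distinct coordinates are independent. The factor [B ^ 2] avoids the exponent
    [d - 2]. *)
Lemma cnt_pair B d (p : pred nat) (i j : 'I_d) : i != j ->
  (B ^ 2 * cnt B d (fun s => p (nth 0%N s i) && p (nth 0%N s j)) =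
   (\sum_(a < B) p a) ^ 2 * B ^ d)%N.
Proof.
move=> ij; pose P t a := ((t == i :> nat) || (t == j :> nat)) ==> p a.
have -> : cnt B d (fun s => p (nth 0%N s i) && p (nth 0%N s j)) =
    cnt B d (fun s => all (fun t => P t (nth 0%N s t)) (iota 0 d)).
  apply: eq_bigr => s _; congr nat_of_bool; apply/idP/allP => [/andP[pi pj] t _|h].
    by apply/implyP => /orP[] /eqP ->.
  apply/andP; split; first by have := h i; rewrite mem_iota/= ltn_ord /P eqxx => /(_ isT).
  by have := h j; rewrite mem_iota/= ltn_ord /P eqxx orbT => /(_ isT).
rewrite cnt_box (bigD1 i)//= (bigD1 j)//=; last by rewrite eq_sym.
have BE : (B ^ d = B * (B * \prod_(t < d | (t != i) && (t != j)) B))%N.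
  rewrite -[in LHS](card_ord d) -prod_nat_const (bigD1 i)//= (bigD1 j)//=.
  by rewrite eq_sym.
have -> : (\prod_(t < d | (t != i) && (t != j)) \sum_(a < B) P t a =
    \prod_(t < d | (t != i) && (t != j)) B)%N.
  apply: eq_bigr => t /andP[ti tj]; rewrite -[RHS]card_ord -sum1_card; apply: eq_bigr => a _.
  by rewrite /P !(inj_eq val_inj) (negbTE ti) (negbTE tj).
have -> : (\sum_(a < B) P i a = \sum_(a < B) p a)%N.
  by apply: eq_bigr => a _; rewrite /P eqxx.
have -> : (\sum_(a < B) P j a = \sum_(a < B) p a)%N.
  by apply: eq_bigr => a _; rewrite /P eqxx orbT.
by rewrite BE; move: (\sum_(a < B) p a)%N (\prod_(_ < _ | _) _)%N => u v; rewrite -!mulnn; lia.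
Qed.

Definition near_ends (N m : nat) : pred nat :=
  fun u => (u %% N < m)%N || (N <= u %% N + m)%N.

Lemma near_ends_card N m l : (0 < N)%N ->
  (\sum_(u < N * l) near_ends N m u <= l * m.*2)%N.
Proof.
move=> N0; rewrite -(sum_iota _ (fun u => near_ends N m u : nat)).
have -> : (\sum_(u <- iota 0 (N * l)) near_ends N m u)%N =
    size [seq u <- iota 0 (N * l) | near_ends N m u].
  by rewrite size_filter -sum1_count [RHS]big_mkcond; apply: eq_bigr => u _; case: near_ends.
have -> : (l * m.*2 = size [seq (q * N + b)%N | q <- iota 0 l, b <- iota 0 m ++ iota (N - m) m])%N.
  by rewrite size_allpairs size_cat !size_iota addnn.
apply: uniq_leq_size; first by rewrite filter_uniq ?iota_uniq.
move=> u; rewrite mem_filter mem_iota/= add0n => /andP[un uN].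
apply/allpairsP; exists (u %/ N, u %% N)%N; split=> /=; last exact: divn_eq.
  by rewrite mem_iota/= add0n ltn_divLR// mulnC.
rewrite mem_cat !mem_iota/= add0n.
have := ltn_pmod u N0; case/orP: un => [->//|]; lia.
Qed.

(** * The exceptional set near the corners *)

Section bad_set.
Context {R : realType} {d n : nat} (dn : (d < n)%N) (d0 : (0 < d)%N) (M : nat).
Local Notation L := (mesh d).
Local Notation c := (branching d).
Local Notation tau := (jump R d).

(** A cell side of level [k] consists of [c * (k + 1)] sides of level [k + 1]; [M * c] of these have
    length [M * jump k]. *)
Let near k : pred nat := near_ends (c * k.+1) (M * c).

Definition near_corner (k : nat) : pred (seq nat) := fun u =>
  has (fun ij : 'I_d * 'I_d => [&& ij.1 != ij.2, near k (nth 0%N u ij.1) & near k (nth 0%N u ij.2)])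
    (enum {: 'I_d * 'I_d}).

Definition corner_set (k : nat) : set 'rV[R]_d :=
  [set x | nonneg_below 1 x /\ near_corner k (idx (L k.+1) x)].

(** In one direction the proportion of indices near an end is at most [2 * M / (k + 1)]. It is
    squared for two directions, and there are at most [d ^ 2] pairs. *)
Lemma cnt_near_corner k :
  (L k.+1 ^ 2 * cnt (L k.+1) d (near_corner k) <=
   d ^ 2 * (L k * (M * c).*2) ^ 2 * L k.+1 ^ d)%N.
Proof.
pose r := [seq ij <- enum {: 'I_d * 'I_d} | ij.1 != ij.2].
pose Q (ij : 'I_d * 'I_d) (u : seq nat) := near k (nth 0%N u ij.1) && near k (nth 0%N u ij.2).
have : (cnt (L k.+1) d (near_corner k) <= \sum_(ij <- r) cnt (L k.+1) d (Q ij))%N.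
  apply: leq_cnt_union => u _ /hasP[ij ijin /and3P[ij12 n1 n2]]; exists ij.
    by rewrite mem_filter ij12.
  by rewrite /Q n1 n2.
move=> /(leq_mul (leqnn (L k.+1 ^ 2)))/leq_trans; apply.
rewrite big_distrr/= big_seq.
apply: (@leq_trans (\sum_(ij <- r) ((L k * (M * c).*2) ^ 2 * L k.+1 ^ d))).
  rewrite [leqRHS]big_seq; apply: leq_sum => ij; rewrite mem_filter => /andP[ij12 _].
  rewrite cnt_pair// leq_mul2r leq_sqr; apply/orP; right.
  by have := @near_ends_card (c * k.+1) (M * c) (L k); rewrite -meshS; apply; rewrite muln_gt0 branching_gt0.
rewrite big_const_seq count_predT iter_addn_0 mulnC -mulnA leq_mul2r; apply/orP; right.
apply: (@leq_trans (size (enum {: 'I_d * 'I_d}))); first by rewrite size_filter count_size.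
by rewrite -cardT card_prod card_ord mulnn.
Qed.

Local Notation graph := (@graph R d n).

Lemma hausdorff_delta_corner_set (delta : R) k : d.+1%:R / (L k.+1)%:R <= delta ->
  (hausdorff_delta d delta (graph @` corner_set k) <=
   ((d.+1%:R ^+ d * (d%:R * (2 * M%:R)) ^+ 2) / (k.+1%:R ^+ 2))%:E)%E.
Proof.
move=> Ld; pose S := [seq u <- grid (L k.+1) d | near_corner k u].
apply: le_trans (hausdorff_delta_cells dn d0 (S := S) Ld _ _) _.
- by move=> x [].
- move=> x [x1 xk]; rewrite mem_filter xk.
  by have := @idx_grid R d (L k.+1) 1 x (mesh_gt0 d _) x1; rewrite mul1n.
rewrite lee_fin -cntE.
move: (cnt_near_corner k); set C := cnt _ _ _ => HN.
have H : (L k.+1)%:R ^+ 2 * C%:R <=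
    d%:R ^+ 2 * ((L k)%:R * (M * c).*2%:R) ^+ 2 * (L k.+1)%:R ^+ d :> R.
  move: HN; move: (L k.+1) (L k) ((M * c).*2)%N C => a b e C' HN.
  by rewrite -(ler_nat R) !(natrX, natrM) in HN.
have b0 : 0 < c%:R :> R by rewrite ltr0n.
have l0 : 0 < (L k)%:R :> R by rewrite ltr0n.
have k0 : 0 < k.+1%:R :> R by [].
have Lk0 : 0 < (L k.+1)%:R :> R by rewrite ltr0n.
have LE : (L k.+1)%:R = c%:R * k.+1%:R * (L k)%:R :> R by rewrite meshS !(natrM _ (c * _)) (natrM _ c).
have Ld0 : 0 < (L k.+1)%:R ^+ d :> R by rewrite exprn_gt0.
have L20 : 0 < (L k.+1)%:R ^+ 2 :> R by rewrite exprn_gt0.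
have HC : C%:R / (L k.+1)%:R ^+ d <= (d%:R * (2 * M%:R)) ^+ 2 / k.+1%:R ^+ 2 :> R.
  rewrite ler_pdivrMr// mulrAC ler_pdivlMr ?exprn_gt0// -(ler_pM2l L20).
  apply: (@le_trans _ _ (d%:R ^+ 2 * ((L k)%:R * (M * c).*2%:R) ^+ 2 * (L k.+1)%:R ^+ d * k.+1%:R ^+ 2)).
    by rewrite mulrA ler_wpM2r ?exprn_ge0.
  have -> : (M * c).*2%:R = 2 * M%:R * c%:R :> R by rewrite -muln2 (natrM _ (M * c)) (natrM _ M); ring.
  rewrite LE le_eqVlt; apply/orP; left; apply/eqP.
  by move: (c%:R) (_ ^+ d) => b D; ring.
rewrite expr_div_n mulrCA -[leRHS]mulrA ler_wpM2l ?exprn_ge0//.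
Qed.

Definition corner_limit : set 'rV[R]_d :=
  [set x | nonneg_below 1 x /\ forall K, exists2 k, (K <= k)%N & corner_set k x].

Lemma nneseries_le (u : nat -> \bar R) (b : \bar R) : (forall k, 0 <= u k)%E ->
  (forall N, \sum_(0 <= k < N) u k <= b)%E -> (\sum_(0 <= k <oo) u k <= b)%E.
Proof.
by move=> u0 ub; apply: lime_le; [exact: is_cvg_nneseries|exact: nearW].
Qed.

(** Telescoping, from [1 / (m + 1) ^ 2 <= 1 / m - 1 / (m + 1)]. *)
Lemma sum_inv_sqr_le (K N : nat) : (0 < K)%N ->
  \sum_(0 <= k < N) ((K + k).+1%:R ^+ 2)^-1 <= (K%:R : R)^-1 - (K + N)%:R^-1.
Proof.
move=> K0; elim: N => [|N IHN]; first by rewrite big_geq// addn0 subrr.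
rewrite big_nat_recr//= (le_trans (lerD IHN (lexx _)))//.
rewrite addnS; set m := (K + N)%N; have m0 : 0 < m%:R :> R by rewrite ltr0n addn_gt0 K0.
have m1 : 0 < m.+1%:R :> R by [].
have e : m%:R^-1 - m.+1%:R^-1 = (m%:R * m.+1%:R)^-1 :> R.
  by rewrite -natr1; field; rewrite natr1 !gt_eqF.
have : (m.+1%:R ^+ 2)^-1 <= (m%:R * m.+1%:R)^-1 :> R.
  by rewrite lef_pV2 ?posrE ?exprn_gt0 ?mulr_gt0// expr2 ler_pM2r// ler_nat.
by rewrite -e; move: (K%:R^-1) (m%:R^-1) (m.+1%:R^-1) ((m.+1%:R ^+ 2)^-1) => *; lra.
Qed.

(** Borel-Cantelli at a fixed [delta]: the corner sets from level [K] on cover the set, and their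
    contents add up to at most [C / K]. *)
Lemma hausdorff_corner_limit : hausdorff d (graph @` corner_limit) = 0%E.
Proof.
apply/hausdorff_eq0P => delta delta0; apply/lee_addgt0Pr => e e0; rewrite add0e.
have [K1 HK1] := @mesh_small R d d.+1%:R _ delta0.
set C : R := d.+1%:R ^+ d * (d%:R * (2 * M%:R)) ^+ 2.
have C0 : 0 <= C by rewrite mulr_ge0 ?exprn_ge0.
pose K := (K1 + (Num.truncn (C / e)).+1)%N.
have K0 : (0 < K)%N by rewrite /K addnS.
have CK : C / K%:R <= e.
  rewrite ler_pdivrMr ?ltr0n// mulrC -ler_pdivrMr//.
  by rewrite (le_trans (ltW (truncnS_gt _)))// ler_nat leq_addl.
apply: (@le_trans _ _ (hausdorff_delta d delta (\bigcup_k (graph @` corner_set (K + k))))).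
  apply: le_hausdorff_delta_set => _ [x [_ xinf] <-].
  have [k Kk xk] := xinf K; exists (k - K)%N => //; exists x => //.
  by rewrite subnKC.
apply: (le_trans (hausdorff_delta_bigcup d delta _)).
apply: nneseries_le => [k|N]; first exact: hausdorff_delta_ge0.
apply: (@le_trans _ _ (\sum_(0 <= k < N) (C / (K + k).+1%:R ^+ 2)%:E)%E).
  apply: lee_sum => k _; apply: hausdorff_delta_corner_set; apply: HK1.
  by rewrite /K; lia.
rewrite sumEFin lee_fin -mulr_sumr (le_trans _ CK)// ler_wpM2l//.
rewrite (le_trans (sum_inv_sqr_le _ K0))// gerBl//.
Qed.

End bad_set.

Section density.
Context {R : realType} {d n : nat} (dn : (d < n)%N) (d0 : (0 < d)%N) (M : nat).
Local Notation L := (mesh d).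
Local Notation c := (branching d).
Local Notation tau := (jump R d).
Local Notation graph := (@graph R d n).
Local Notation E := (@graph_set R d n).

Lemma coarse_interval (y : R) (G v N : nat) : (0 < N)%N ->
  (v * N)%:R <= y * (N * G)%:R < (v.+1 * N)%:R -> v%:R <= y * G%:R < v.+1%:R.
Proof.
move=> N0; have Nr : 0 < N%:R :> R by rewrite ltr0n.
by rewrite !natrM [N%:R * _]mulrC mulrA ler_pM2r// ltr_pM2r.
Qed.

(* Outside of the corners, all coordinates but one stay in their level-[k]
   interval when moved by less than [M * tau k], and the remaining one does so
   on one of its two sides. *)
Lemma half_ball_in_cell k (x : 'rV[R]_d) (h : R) : nonneg_below 1 x ->
  (2 * M <= k.+1)%N -> ~ corner_set M k x -> h <= M%:R * tau k ->
  exists a b, forall y, half_ball x h a b y ->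
    nonneg_below 1 y /\ idx (L k) y = idx (L k) x.
Proof.
move=> x1 Mk nbad hM.
set N := (c * k.+1)%N; have N0 : (0 < N)%N by rewrite muln_gt0 branching_gt0.
have LN : L k.+1 = (N * L k)%N by exact: meshS.
have Lk1 : 0 < (L k.+1)%:R :> R by exact: mesh_gtr0.
have Lk : 0 < (L k)%:R :> R by exact: mesh_gtr0.
have hMc : h * (L k.+1)%:R <= (M * c)%:R.
  rewrite (le_trans (ler_wpM2r (ltW Lk1) hM))// /jump -mulrA divfK ?gt_eqF//.
  by rewrite natrM.
pose u i := Num.truncn (x ord0 i * (L k.+1)%:R).
have uE (i : 'I_d) : nth 0%N (idx (L k.+1) x) i = u i by exact: nth_idx.
have vE i : Num.truncn (x ord0 i * (L k)%:R) = (u i %/ N)%N.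
  by rewrite /u LN truncn_divn.
have ux i : (u i)%:R <= x ord0 i * (L k.+1)%:R < (u i).+1%:R.
  by apply: truncn_itv; rewrite mulr_ge0//; have /andP[] := x1 i.
have MN : (2 * (M * c) <= N)%N by rewrite mulnA mulnC leq_mul2l Mk orbT.
have stay (y : 'rV[R]_d) i : `|y ord0 i - x ord0 i| < h ->
    (M * c <= u i %% N)%N \/ x ord0 i <= y ord0 i ->
    (u i %% N + M * c < N)%N \/ y ord0 i <= x ord0 i ->
    (u i %/ N)%:R <= y ord0 i * (L k)%:R < (u i %/ N).+1%:R.
  rewrite -(ltr_pM2r Lk1) -{1}(ger0_norm (ltW Lk1)) -normrM mulrBl => yx left right.
  have := divn_eq (u i) N; have := ltn_pmod (u i) N0; have := ux i.
  move: left right; move: (u i %% N)%N (u i %/ N)%N => b v left right /andP[ul ur] bN ub.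
  have {yx} /andP[yl yr] : - (M * c)%:R < y ord0 i * (L k.+1)%:R - x ord0 i * (L k.+1)%:R < (M * c)%:R.
    by have := lt_le_trans yx hMc; rewrite ltr_norml.
  apply: (coarse_interval N0); rewrite -LN; apply/andP; split.
    case: left => [Mb|xy].
      have : (v * N + M * c)%:R <= (u i)%:R :> R by rewrite ler_nat; lia.
      by rewrite natrD; lra.
    have : (v * N)%:R <= (u i)%:R :> R by rewrite ler_nat; lia.
    by have := ler_wpM2r (ltW Lk1) xy; lra.
  case: right => [Mb|xy].
    have : ((u i).+1 + M * c)%:R <= (v.+1 * N)%:R :> R by rewrite ler_nat; lia.
    by rewrite natrD; lra.
  have : (u i).+1%:R <= (v.+1 * N)%:R :> R by rewrite ler_nat; lia.
  by have := ler_wpM2r (ltW Lk1) xy; lra.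
have cell (y : 'rV[R]_d) : (forall i, (u i %/ N)%:R <= y ord0 i * (L k)%:R < (u i %/ N).+1%:R) ->
    nonneg_below 1 y /\ idx (L k) y = idx (L k) x.
  move=> yu; split=> [i|]; last first.
    by apply/idxP => i; rewrite vE; exact: truncn_def.
  have /andP[yl yr] := yu i; apply/andP; split.
    by rewrite -(pmulr_lge0 _ Lk) (le_trans _ yl).
  rewrite -(ltr_pM2r Lk) mul1r (lt_le_trans yr)// ler_nat -vE.
  rewrite truncn_lt_nat; first by have /andP[_] := x1 i; rewrite -(ltr_pM2r Lk) mul1r.
  by rewrite mulr_ge0// ?(ltW Lk)//; have /andP[] := x1 i.
(* Outside the corner set at most one direction is near an end; if none is, direction 0 serves. *)
have [a far] : exists a, forall i, i != a -> ~~ near_ends N (M * c) (u i).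
  have [[a na]|none] := pselect (exists a, near_ends N (M * c) (u a)); last first.
    by exists (Ordinal d0) => i _; apply/negP => ni; apply: none; exists i.
  exists a => i ia; apply/negP => ni; apply: nbad; split=> //.
  by apply/hasP; exists (i, a); rewrite ?mem_enum//= ia !uE ni na.
(* If the lower end is far, the half ball points downwards; otherwise it points upwards, where the
   end is far because [2 * (M * c) <= N]. *)
exists a, (M * c <= u a %% N)%N => y [yh ya]; apply: cell => i; apply: stay.
- by rewrite distrC; exact: le_lt_trans (edist_coord x y i) yh.
- have [->|/far] := eqVneq i a; last by rewrite /near_ends negb_or -leqNgt => /andP[]; left.
  case: (leqP (M * c) (u a %% N)) ya => [_ _|_]; first by left.
  by rewrite /= expr0 mul1r subr_ge0; right.
- have [->|/far] := eqVneq i a; last by rewrite /near_ends negb_or => /andP[_ +]; rewrite -ltnNge; left.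
  case: (leqP (M * c) (u a %% N)) ya => [_|lt _]; last by left; lia.
  by rewrite /= expr1 mulN1r oppr_ge0 subr_le0; right.
Qed.

Lemma density_bound (x : 'rV[R]_d) : nonneg_below 1 x -> ~ corner_limit M x ->
  2 ^+ d.+1 < M%:R :> R ->
  (((1 - 2 ^+ d.+1 / M%:R) ^+ d / 2)%:E <= lower_density d E (graph x))%E.
Proof.
move=> x1 nlim M2; have M0 : 0 < M%:R :> R by apply: lt_trans M2; rewrite exprn_gt0.
set theta := 2 ^+ d.+1 / M%:R.
have theta1 : theta < 1 by rewrite ltr_pdivrMr// mul1r.
have [K0 HK0] : exists K, forall k, (K <= k)%N -> ~ corner_set M k x.
  apply: contrapT => /forallNP nK; apply: nlim; split=> // K.
  have /existsNP[k /not_implyP[Kk /contrapT xk]] := nK K.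
  by exists k.
pose K := (K0 + 2 * M)%N.
set rho := M%:R * tau K.
have rho0 : 0 < rho by rewrite mulr_gt0// jump_gt0.
rewrite /lower_density limf_einfE.
apply: le_trans (ereal_sup_ubound _); last first.
  exists [set h | 0 < h < rho]; last reflexivity.
  near=> h; apply/andP; split; first by near: h; exact: nbhs_right_gt.
  by near: h; exact: nbhs_right_lt.
apply: le_ereal_inf_tmp => _ [h /andP[h0 hrho] <-].
have exk : exists k, M%:R * tau k <= h.
  have [k /(_ k (leqnn k)) Hk] := @mesh_small R d M%:R _ h0; exists k.
  by apply: le_trans Hk; rewrite ler_wpM2l ?ler0n// jump_mesh.
(* [m] is the first level with [M * jump m <= h]; its predecessor is the level whose cell is
   used. *)
case: (ex_minnP exk) => m hm mmin.
have Km : (K < m)%N.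
  rewrite ltnNge; apply/negP => mK; move: hrho; rewrite ltNge => /negP; apply.
  by apply: le_trans hm; rewrite ler_wpM2l ?ler0n// le_jump.
case: m Km hm mmin => // k Kk hk mmin.
have hk' : h <= M%:R * tau k.
  by rewrite leNgt; apply/negP => /ltW /mmin; rewrite ltnn.
have [||a [b Hab]] := @half_ball_in_cell k x h x1 _ _ hk'.
- by rewrite /K in Kk; lia.
- by apply: HK0; rewrite /K in Kk; lia.
(* The smaller radius leaves room [theta * h] for the variation of the height over the cell. *)
pose h' := h * (1 - theta).
have h'0 : 0 < h' by rewrite mulr_gt0// subr_gt0.
have sub : graph @` half_ball x h' a b `<=` E `&` eball (graph x) h.
  move=> _ [y yH <-].
  have yH' : half_ball x h a b y.
    case: yH => yh ?; split=> //; apply: lt_le_trans yh _.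
    rewrite ger_pMr// gerBl divr_ge0 ?exprn_ge0//.
  have [y1 yx] := Hab y yH'; split; first by exists y.
  rewrite /eball/=; apply: (le_lt_trans (graph_le dn _ _)).
  have hc : `|height x - height y| <= theta * h.
    apply: (le_trans (height_close (esym yx))).
    rewrite /theta -mulrA ler_wpM2l ?exprn_ge0// mulrC ler_pdivlMr//.
    by rewrite mulrC.
  by case: yH => yh _; move: yh; rewrite /h' mulrBr mulr1 (mulrC h); lra.
(* The projection is 1-Lipschitz and inverts [graph], so the bound for the flat half ball passes to
   the graph. *)
have lb : (((2 * h') ^+ d / 2)%:E <= hausdorff d (E `&` eball (graph x) h))%E.
  apply: le_trans (hausdorff_delta_half_ball d0 x a b h'0 ltr01) _.
  apply: le_trans (hausdorff_delta_le d _ ltr01).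
  apply: le_trans (le_hausdorff_delta_set _ _ sub).
  rewrite -{1}[half_ball x h' a b](_ : proj dn @` (graph @` half_ball x h' a b) = _).
    by apply: hausdorff_delta_image => y z _ _; exact: proj_dist.
  by apply/seteqP; split=> [_ [_ [y yH <-] <-]|y yH];
    rewrite ?graphK//; exists (graph y); [exists y|exact: graphK].
have hd : 0 < (2 * h) ^+ d by rewrite exprn_gt0// mulr_gt0.
apply: le_trans (lee_wpmul2r _ lb); last by rewrite lee_fin invr_ge0 ltW.
rewrite -EFinM lee_fin (_ : 2 * h' = 2 * h * (1 - theta)); last by rewrite /h' mulrA.
rewrite exprMn le_eqVlt; apply/orP; left; apply/eqP.
by move: hd; move: ((2 * h) ^+ d) ((1 - theta) ^+ d) => A B A0; field; rewrite gt_eqF.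
Unshelve. all: by end_near. Qed.

End density.

(** * Unrectifiability *)

Lemma harmonic_unbounded (R : realType) (B : R) :
  exists n, B < \sum_(0 <= k < n) k.+1%:R^-1.
Proof.
apply: contrapT => /forallNP bnd; apply: (@dvg_harmonic R).
apply: nondecreasing_is_cvgn.
  by apply/nondecreasing_seqP => n; rewrite seriesSr lerDl invr_ge0.
by exists B => _ [n _ <-]; rewrite leNgt; apply/negP/bnd.
Qed.

Section unrectifiable.
Context {R : realType} {d n : nat} (dn : (d < n)%N) (d0 : (0 < d)%N).
Local Notation L := (mesh d).
Local Notation c := (branching d).
Local Notation tau := (jump R d).
Local Notation graph := (@graph R d n).
Local Notation E := (@graph_set R d n).
Local Notation proj := (proj dn).

(** * Growth of the neighbourhoods of a Lipschitz domain *)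

Section growth.
Context (A : set 'rV[R]_d) (g : 'rV[R]_d -> 'rV[R]_n) (Lip m : nat).
Hypothesis Lip0 : (0 < Lip)%N.
Hypothesis Am : A `<=` nonneg_below m%:R.
Hypothesis gLip : forall x y, A x -> A y -> edist (g x) (g y) <= Lip%:R * edist x y.
Hypothesis gE : g @` A `<=` E.

Variables (K' : nat).
(* The counting grid has mesh [1 / G]; in that unit the level-[k] neighbourhoods
   have side [rad k]. *)
Let Lam := L K'.+1.
Let G := (8 * d * Lip * Lam)%N.
Let rad k := (Lam %/ L k.+1)%N.
Let N := (m * G)%N.

Let Lam0 : (0 < Lam)%N := mesh_gt0 d K'.+1.
Let G0 : (0 < G)%N. Proof. by rewrite /G !muln_gt0 d0 Lip0 Lam0. Qed.

Let radE k : (k <= K')%N -> (rad k * L k.+1)%N = Lam.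
Proof. by move=> kK; apply: divnK; exact: dvdn_mesh. Qed.

Let rad_gt0 k : (k <= K')%N -> (0 < rad k)%N.
Proof. by move=> /radE; rewrite -[(0 < _)%N]negbK -leqNgt leqn0; case: eqP => // ->; have := Lam0; lia. Qed.

Let radS k : (k < K')%N -> rad k = (rad k.+1 * (c * k.+2))%N.
Proof.
move=> kK; apply/eqP; rewrite -(eqn_pmul2r (mesh_gt0 d k.+1)) radE 1?ltnW//.
by rewrite -mulnA -meshS radE.
Qed.

Definition occupied : pred (seq nat) := fun z => `[< exists2 a, A a & idx G a = z >].

Definition occupied_in (k : nat) (u : seq nat) : pred (seq nat) :=
  fun z => `[< exists a, [/\ A a, idx G a = z & idx (L k) (proj (g a)) = u] >].

Let graphE a : A a -> exists2 x, nonneg_below 1 x & g a = graph x.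
Proof. by move=> Aa; have [x x1 gx] := gE (imageP g Aa); exists x. Qed.

Let proj_below a : A a -> nonneg_below 1 (proj (g a)).
Proof. by move=> /graphE[x x1 ->]; rewrite graphK. Qed.

Let proj_grid k a : A a -> idx (L k) (proj (g a)) \in grid (L k) d.
Proof.
move=> /proj_below a1.
by have := @idx_grid R d (L k) 1 _ (mesh_gt0 d _) a1; rewrite mul1n.
Qed.

Let occupied_grid a : A a -> idx G a \in grid N d.
Proof. by move=> /Am; exact: idx_grid. Qed.

Let separated k a b : A a -> A b ->
  idx (L k) (proj (g a)) <> idx (L k) (proj (g b)) -> tau k / 2 <= edist (g a) (g b).
Proof.
move=> /graphE[x x1 ->] /graphE[y y1 ->]; rewrite !graphK.
exact: (graph_separated dn x1 y1).
Qed.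

Let GE : G%:R = 8 * d%:R * Lip%:R * Lam%:R :> R.
Proof. by rewrite /G !natrM. Qed.

(** The purpose of the factor [8 * d * Lip] in [G]: the part of [A] in one counting cell has an
    image of diameter at most [1 / (8 * Lam)]. *)
Let LipG : Lip%:R * (d%:R / G%:R) = (8 * Lam%:R)^-1 :> R.
Proof.
have l0 : Lip%:R != 0 :> R by rewrite pnatr_eq0 -lt0n.
have dr0 : d%:R != 0 :> R by rewrite pnatr_eq0 -lt0n.
have la0 : Lam%:R != 0 :> R by rewrite pnatr_eq0 -lt0n.
by rewrite GE; field; rewrite l0 dr0 la0.
Qed.

(** If the thickenings meet, the images of two points over different cells are at distance at most
    [(rad k + 1) / (8 * Lam)], hence at most [1 / (4 * mesh k.+1)]. This is less than [jump k / 2],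
    against the separation of the graph. *)
Let disjoint k u v s : (k <= K')%N ->
  thicken N d (rad k) (occupied_in k u) s -> thicken N d (rad k) (occupied_in k v) s -> u = v.
Proof.
move=> kK /thickenP[p [pN /asboolP[a [Aa <- <-]] ps]] /thickenP[q [qN /asboolP[b [Ab <- <-]] qs]].
apply: contrapT => uv; have := separated Aa Ab uv; apply/negP; rewrite -ltNge.
apply: (le_lt_trans (gLip Aa Ab)).
have r0 := rad_gt0 kK.
have Gr : 0 < G%:R :> R by rewrite ltr0n.
have ab : edist a b <= d%:R * ((rad k).+1%:R / G%:R).
  apply: edist_coord_le => [|i]; first by rewrite divr_ge0.
  rewrite ler_pdivlMr// -{1}(ger0_norm (ltW Gr)) -normrM mulrBl.
  have := ps i (ltn_ord i); have := qs i (ltn_ord i); rewrite !nth_idx.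
  have /andP[a0 _] := Am Aa i; have /andP[b0 _] := Am Ab i.
  have := truncn_itv (mulr_ge0 a0 (ltW Gr)); have := truncn_itv (mulr_ge0 b0 (ltW Gr)).
  move: (Num.truncn _) (Num.truncn _) => x y hx hy hq hp.
  have xy : (x <= y + rad k)%N by lia.
  have yx : (y <= x + rad k)%N by lia.
  move: xy yx; rewrite -!(ler_nat R) !natrD => xy yx.
  by move: hx hy; rewrite -!natr1 ler_norml; lra.
apply: (le_lt_trans (ler_wpM2l _ ab)) => //.
have -> : Lip%:R * (d%:R * ((rad k).+1%:R / G%:R)) = (rad k).+1%:R * (8 * Lam%:R)^-1 :> R.
  by rewrite -LipG; ring.
have L0 : 0 < (L k.+1)%:R :> R by exact: mesh_gtr0.
have rr : 1 <= (rad k)%:R :> R by rewrite ler1n.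
have c1 : 1 <= c%:R :> R by rewrite ler1n.
rewrite -(radE kK) natrM /jump -natr1 mulrAC ltr_pdivrMr ?mulr_gt0// ?ltr0n//.
have -> : c%:R / 2 / (L k.+1)%:R * (8 * ((rad k)%:R * (L k.+1)%:R)) = 4 * c%:R * (rad k)%:R :> R.
  by move: (c%:R) => e; field; rewrite gt_eqF.
have := ler_wpM2r (le_trans ler01 rr) c1; lra.
Qed.

Let vol k := cnt (N + rad k) d (thicken N d (rad k) occupied).

Let vol_ge k : (k <= K')%N ->
  (\sum_(u <- grid (L k) d) cnt (N + rad k) d (thicken N d (rad k) (occupied_in k u)) <= vol k)%N.
Proof.
move=> kK; apply: leq_cnt_disjoint; first exact: grid_uniq.
  move=> u s _ _ /thickenP[p [pN /asboolP[a [Aa ap _]] ps]].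
  by apply/thickenP; exists p; split=> //; apply/asboolP; exists a.
by move=> u v s _ _ _; exact: disjoint.
Qed.

(** The same pieces of level [k] as in [vol_ge], now with the radius of level [k + 1]: the growth
    between the two radii can be estimated piece by piece. *)
Let vol_le k : (vol k.+1 <=
  \sum_(u <- grid (L k) d) cnt (N + rad k.+1) d (thicken N d (rad k.+1) (occupied_in k u)))%N.
Proof.
apply: leq_cnt_union => s _ /thickenP[p [pN /asboolP[a Aa ap] ps]].
exists (idx (L k) (proj (g a))); first exact: proj_grid.
by apply/thickenP; exists p; split=> //; apply/asboolP; exists a.
Qed.

(** The ratio of two diameter bounds: [(d + 1) / mesh k] for the graph over a cell of level [k], and
    [1 / (8 * Lam)] for the image of a counting cell; see [width_mesh]. *)
Let width k := (8 * d.+1 * (c * k.+1) * rad k)%N.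

(** The isoperimetric inequality [cnt_thicken] is applied to each piece, from radius [rad k.+1] to
    radius [rad k]. *)
Let vol_step k : (k < K')%N ->
  ((rad k - rad k.+1) * (\sum_(u <- grid (L k) d) minn (cnt N d (occupied_in k u)) (width k ^ d))
    + width k * vol k.+1 <= width k * vol k)%N.
Proof.
move=> kK; set t := (rad k - rad k.+1)%N; set W := width k.
have rk : (rad k.+1 + t)%N = rad k.
  by rewrite subnKC// (radS kK) leq_pmulr// muln_gt0 branching_gt0.
apply: leq_trans (leq_mul (leqnn W) (vol_ge (ltnW kK))).
apply: (leq_trans (leq_add (leqnn _) (leq_mul (leqnn W) (vol_le k)))).
rewrite !big_distrr/= -big_split/=; apply: leq_sum => u _.
set P := thicken N d (rad k.+1) (occupied_in k u).
have := @cnt_thicken (N + rad k.+1) d t W P d0; rewrite -addnA rk => H.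
apply: leq_trans (leq_trans H _).
  rewrite leq_add2r leq_mul2l leq_min geq_minr andbT; apply/orP; right.
  apply: leq_trans (geq_minl _ _) _.
  apply: leq_trans (leq_cnt_window _ _ (leq_addr (rad k.+1) N)).
  apply: cnt_le => s sN Os; apply/thickenP; exists s; split=> // i _.
  by rewrite leqnn leq_addr.
rewrite leq_mul2l; apply/orP; right; apply: cnt_le => s _ /thickenP[p [_ /thickenP[q [qN Oq qp] ps]]].
apply/thickenP; exists q; split=> // i id; have := qp i id; have := ps i id; lia.
Qed.

Lemma width_mesh k : (k <= K')%N -> (width k)%:R = 8 * Lam%:R * (d.+1%:R / (L k)%:R) :> R.
Proof.
move=> kK; rewrite -(radE kK) (meshS d k) /width.
have l0 : (L k)%:R != 0 :> R by rewrite pnatr_eq0 -lt0n.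
by move: l0; move: (branching d) (L k) (rad k) => b l r l0; rewrite !natrM; field.
Qed.

Variable (delta : R).
Hypothesis delta0 : 0 < delta.

Let piece k u := g @` [set a | A a /\ idx (L k) (proj (g a)) = u].

(** The minimum comes from two covers: the images of the occupied counting cells, or the whole piece
    as one set, since it lies over a single cell of level [k]. *)
Let hausdorff_piece k u : (k <= K')%N -> d.+1%:R / (L k)%:R <= delta ->
  (hausdorff_delta d delta (piece k u) <=
   ((minn (cnt N d (occupied_in k u)) (width k ^ d))%:R * (8 * Lam%:R)^-1 ^+ d)%:E)%E.
Proof.
move=> kK kdelta; have la0 : 0 < Lam%:R :> R by rewrite ltr0n.
have lad : (8 * Lam%:R)^-1 <= delta.
  apply: le_trans kdelta; rewrite -[leLHS]mul1r ler_pM ?invr_ge0 ?mulr_ge0 ?ler1n//.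
  rewrite lef_pV2 ?posrE ?mulr_gt0 ?mesh_gtr0// -natrM ler_nat.
  by apply: leq_trans (leq_pmull _ _) => //; apply: dvdn_leq => //; apply: dvdn_mesh; exact: leqW.
rewrite /minn; case: ifP => _.
  rewrite cntE.
  pose F z := g @` [set a | [/\ A a, idx G a = z & idx (L k) (proj (g a)) = u]].
  apply: (@hausdorff_delta_cover _ _ _ _ d0 (ltW delta0) _ _ F).
  - by rewrite invr_ge0 mulr_ge0.
  - move=> _ [a [Aa au] <-]; exists (idx G a); last by exists a.
    by rewrite mem_filter occupied_grid// andbT; apply/asboolP; exists a.
  - move=> z _ _ _ [a [Aa az au] <-] [b [Ab bz bu] <-].
    rewrite (le_trans (gLip Aa Ab))// -LipG ler_wpM2l//.
    by apply: (idx_edist G0 (Am Aa) (Am Ab)); rewrite az bz.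
rewrite natrX -exprMn width_mesh// mulrC mulKf ?gt_eqF ?mulr_gt0//.
rewrite -[in leRHS](mul1r (_ ^+ d)).
apply: (@hausdorff_delta_cover _ _ _ _ d0 (ltW delta0) _ [:: tt] (fun=> piece k u)).
- by rewrite kdelta divr_ge0.
- by move=> x Sx; exists tt.
- move=> _ _ _ _ [a [Aa au] <-] [b [Ab bu] <-].
  have [x x1 gx] := graphE Aa; have [y y1 gy] := graphE Ab.
  move: au bu; rewrite gx gy !graphK => xu yu.
  by apply: (graph_cell_diam dn x1 y1); rewrite xu yu.
Qed.

Let hausdorff_le_sum k : (k <= K')%N -> d.+1%:R / (L k)%:R <= delta ->
  (hausdorff_delta d delta (g @` A) <=
   ((\sum_(u <- grid (L k) d) minn (cnt N d (occupied_in k u)) (width k ^ d))%:R *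
     (8 * Lam%:R)^-1 ^+ d)%:E)%E.
Proof.
move=> kK kdelta.
apply: (@le_trans _ _ (\sum_(u <- grid (L k) d) hausdorff_delta d delta (piece k u))%E).
  apply: hausdorff_delta_seq => //; first exact: ltW.
  by move=> _ [a Aa <-]; exists (idx (L k) (proj (g a))); [exact: proj_grid|exists a].
rewrite natr_sum mulr_suml -sumEFin; apply: lee_sum => u _; exact: hausdorff_piece.
Qed.

(** The steps telescope. Each gains a multiple of [mu * rad k / width k], which is proportional to
    [mu / (k + 1)], and the total is at most the volume of the counting window. In the bound all
    dependence on [K'] cancels. *)
Lemma harmonic_bound (K : nat) (mu : R) : (K <= K')%N -> 0 <= mu ->
  (forall k, (K <= k)%N -> d.+1%:R / (L k)%:R <= delta) ->
  (mu%:E <= hausdorff_delta d delta (g @` A))%E ->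
  mu * \sum_(K <= k < K') k.+1%:R^-1 <= 16 * d.+1%:R * c%:R * (m.+1 * d * Lip)%:R ^+ d.
Proof.
move=> KK' mu0 Kdelta muA.
have la0 : 0 < 8 * Lam%:R :> R by rewrite mulr_gt0// ltr0n.
pose D : R := (8 * Lam%:R) ^+ d; have D0 : 0 < D by rewrite exprn_gt0.
have step k : (K <= k < K')%N ->
    mu * D / (16 * d.+1%:R * c%:R) * k.+1%:R^-1 <= (vol k)%:R - (vol k.+1)%:R.
  move=> /andP[Kk kK].
  have := le_trans muA (hausdorff_le_sum (ltnW kK) (Kdelta k Kk)).
  have := vol_step kK; set S := (\sum_(u <- _) _)%N.
  rewrite lee_fin exprVn -/D ler_pdivlMr// -(ler_nat R) natrD (natrM _ (rad k - _)) !(natrM _ (width k)) => vs muS.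
  have r0 : 0 < (rad k)%:R :> R by rewrite ltr0n rad_gt0// ltnW.
  have t2 : (rad k)%:R <= 2 * (rad k - rad k.+1)%:R :> R.
    rewrite -natrM ler_nat (radS kK).
    have : (2 <= c * k.+2)%N by rewrite -[2%N]/(1 * 2)%N leq_mul// branching_gt0.
    by nia.
  have W0 : 0 < (width k)%:R :> R by rewrite /width !natrM !mulr_gt0// ltr0n.
  have WE : (width k)%:R = 8 * d.+1%:R * c%:R * k.+1%:R * (rad k)%:R :> R.
    by rewrite /width; move: (branching d) (rad k) => b r; rewrite !natrM; ring.
  have c0 : 0 < c%:R :> R by rewrite ltr0n.
  rewrite -(ler_pM2l W0) mulrBr.
  apply: (@le_trans _ _ ((rad k)%:R / 2 * (mu * D))).
    rewrite WE le_eqVlt; apply/orP; left; apply/eqP.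
    have k1 : k.+1%:R != 0 :> R by rewrite pnatr_eq0.
    have d1 : d.+1%:R != 0 :> R by rewrite pnatr_eq0.
    have c1 : c%:R != 0 :> R by rewrite gt_eqF.
    by move: (c%:R) (k.+1%:R) (d.+1%:R) c1 k1 d1 => x y z x0 y0 z0; field; rewrite x0 y0 z0.
  have : (rad k)%:R / 2 * (mu * D) <= (rad k - rad k.+1)%:R * S%:R :> R.
    by apply: ler_pM => //; [rewrite mulr_ge0// ltW|lra].
  lra.
have tel : mu * D / (16 * d.+1%:R * c%:R) * \sum_(K <= k < K') k.+1%:R^-1 <= (vol K)%:R.
  rewrite mulr_sumr; apply: (@le_trans _ _ (\sum_(K <= k < K') ((vol k)%:R - (vol k.+1)%:R))).
    by rewrite big_nat_cond [leRHS]big_nat_cond; apply: ler_sum => k; rewrite andbT; exact: step.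
  under eq_bigr do rewrite -opprB.
  by rewrite sumrN (telescope_sumr (fun k => (vol k)%:R))// opprB gerBl.
have volK : (vol K)%:R <= D * (m.+1 * d * Lip)%:R ^+ d.
  have : (vol K <= (N + rad K) ^ d)%N.
    by rewrite -size_grid /vol cntE size_filter count_size.
  rewrite /D -exprMn -!natrM -natrX ler_nat => /leq_trans; apply.
  rewrite leq_exp2r//.
  have : (rad K <= Lam)%N by exact: leq_div.
  rewrite /N /G; have : (1 <= d * Lip)%N by rewrite muln_gt0 d0.
  by move: (rad K) Lam => r l; nia.
have c0 : 0 < c%:R :> R by rewrite ltr0n.
have := le_trans tel volK.
set S := \sum_(K <= k < K') _; set X := _ ^+ d => H.
have q0 : 0 < 16 * d.+1%:R * c%:R :> R by rewrite !mulr_gt0.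
move: H; rewrite mulrAC ler_pdivrMr// => H.
rewrite -(ler_pM2r D0); move: H; move: (16 * _ * _) => q; lra.
Qed.

End growth.

(** A positive content [mu] would bound the harmonic sums from [K] to every [K'] by [B / mu]. *)
Lemma lipschitz_piece_null (A : set 'rV[R]_d) (g : 'rV[R]_d -> 'rV[R]_n) (Lip m : nat) (delta : R) :
  (0 < Lip)%N -> A `<=` nonneg_below m%:R ->
  (forall x y, A x -> A y -> edist (g x) (g y) <= Lip%:R * edist x y) ->
  g @` A `<=` E -> 0 < delta -> (hausdorff_delta d delta (g @` A) <= 0)%E.
Proof.
move=> Lip0 Am gLip gE delta0; rewrite leNgt; apply/negP => pos.
have fin : hausdorff_delta d delta (g @` A) \is a fin_num.
  rewrite ge0_fin_numE ?hausdorff_delta_ge0//.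
  apply: le_lt_trans (le_hausdorff_delta_set _ _ gE) _.
  apply: le_lt_trans (hausdorff_delta_le d _ delta0) _.
  by apply: le_lt_trans (hausdorff_graph_set_le dn d0) _; exact: ltry.
set mu := fine (hausdorff_delta d delta (g @` A)).
have muE : mu%:E = hausdorff_delta d delta (g @` A) by rewrite fineK.
have mu0 : 0 < mu by rewrite -lte_fin muE.
have [K HK] := @mesh_small R d d.+1%:R _ delta0.
set B : R := 16 * d.+1%:R * c%:R * (m.+1 * d * Lip)%:R ^+ d.
(* The terms below [K] are added in advance, since the bounded sum starts at [K]. *)
have [p Hp] := harmonic_unbounded (B / mu + \sum_(0 <= k < K) k.+1%:R^-1).
have := @harmonic_bound A g Lip m Lip0 Am gLip gE (K + p)%N delta delta0 K mu (leq_addr _ _)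
  (ltW mu0) HK.
rewrite muE lexx => /(_ isT); apply/negP; rewrite -ltNge -/B mulrC -ltr_pdivrMr//.
rewrite -(ltrD2r (\sum_(0 <= k < K) k.+1%:R^-1)) (lt_le_trans Hp)//.
rewrite [leRHS]addrC -big_cat_nat ?leq_addr//=.
rewrite [leRHS](@big_cat_nat _ _ _ p)//= ?leq_addl// lerDl.
by apply: sumr_ge0 => k _; rewrite invr_ge0.
Qed.

Lemma hausdorff_delta_bigcup_null (delta : R) (F : nat -> set 'rV[R]_n) :
  (forall i, (hausdorff_delta d delta (F i) <= 0)%E) ->
  (hausdorff_delta d delta (\bigcup_i F i) <= 0)%E.
Proof.
move=> F0; apply: le_trans (hausdorff_delta_bigcup d delta F) _.
rewrite eseries0// => i _ _; apply/eqP.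
by rewrite eq_le F0 hausdorff_delta_ge0.
Qed.

(** The domain is exhausted by bounded pieces, and the [m]-th one is translated by [m] in each
    coordinate to make coordinates nonnegative. *)
Lemma lipschitz_image_null (A : set 'rV[R]_d) (f : 'rV[R]_d -> 'rV[R]_n) (delta : R) :
  lipschitz_from A f -> 0 < delta -> (hausdorff_delta d delta (f @` A `&` E) <= 0)%E.
Proof.
move=> [l Hl] delta0.
(* A positive natural number above [l], which may itself be zero or negative. *)
pose Lip := (Num.truncn `|l|).+1.
have lLip : l <= Lip%:R by rewrite (le_trans (ler_norm l))// ltW// truncnS_gt.
pose sh (m : nat) (x : 'rV[R]_d) := x - const_mx m%:R.
pose A' (m : nat) := [set x | [/\ nonneg_below (2 * m)%:R x, A (sh m x) & E (f (sh m x))]].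
apply: (@le_trans _ _ (hausdorff_delta d delta (\bigcup_m ((f \o sh m) @` A' m)))).
  apply: le_hausdorff_delta_set => _ [[x Ax <-] Efx].
  pose m := (Num.truncn (\sum_i `|x ord0 i|)).+1.
  have xm i : `|x ord0 i| < m%:R.
    apply: le_lt_trans (truncnS_gt _).
    by rewrite (bigD1 i)//= lerDl; apply: sumr_ge0 => j _; exact: normr_ge0.
  have shx : sh m (x + const_mx m%:R) = x by rewrite /sh addrK.
  exists m => //; exists (x + const_mx m%:R); last by rewrite /= shx.
  split; rewrite ?shx// => i; rewrite !mxE natrM.
  by have := xm i; rewrite ltr_norml; lra.
apply: hausdorff_delta_bigcup_null => m.
apply: (@lipschitz_piece_null (A' m) (f \o sh m) Lip (2 * m)) => //.
- by move=> x [].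
- move=> x y [_ Ax _] [_ Ay _] /=; apply: (le_trans (Hl _ _ Ax Ay)).
  have -> : edist (sh m x) (sh m y) = edist x y.
    by congr Num.sqrt; apply: eq_bigr => i _; rewrite !mxE; congr (_ ^+ 2); ring.
  by rewrite ler_wpM2r// edist_ge0.
- by move=> _ [x [_ _ Ef] <-].
Qed.

Lemma graph_set_unrectifiable : ~ rectifiable d E.
Proof.
move=> [A [f [Hf H0]]].
have := @hausdorff_graph_set_gt0 R d n dn; rewrite ltNge => /negP; apply.
apply: hausdorff_le => delta delta0.
pose F i := if i is i'.+1 then f i' @` A i' `&` E else E `\` \bigcup_i (f i @` A i).
apply: (@le_trans _ _ (hausdorff_delta d delta (\bigcup_i F i))).
  apply: le_hausdorff_delta_set => x Ex.
  have [[i _ fx]|nx] := pselect ((\bigcup_i (f i @` A i)) x).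
    by exists i.+1.
  by exists 0%N.
apply: hausdorff_delta_bigcup_null => -[|i] /=.
  by rewrite -H0; exact: hausdorff_delta_le.
exact: lipschitz_image_null.
Qed.

End unrectifiable.

(** * The lower bound for [sigma] *)

Lemma bernoulli_le (R : realType) (t : R) k : 0 <= t <= 1 -> 1 - k%:R * t <= (1 - t) ^+ k.
Proof.
move=> /andP[t0 t1]; elim: k => [|k IHk]; first by rewrite expr0 mul0r subr0.
have t1' : 0 <= 1 - t by lra.
rewrite exprS (le_trans _ (ler_wpM2l t1' IHk))// -natr1.
have := mulr_ge0 (ler0n R k) (sqr_ge0 t); rewrite expr2; nra.
Qed.

Theorem mainTheorem1 (R : realType) (d n : nat) :
  (0 < d)%N -> (d < n)%N -> ((1 / 2 : R)%R%:E <= sigma R d n)%E.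
Proof.
move=> d0 dn; apply: le_ereal_inf_tmp => _ [s [s0 Hs] <-]; rewrite lee_fin leNgt.
apply/negP => s2; apply: (graph_set_unrectifiable dn d0).
apply: (Hs _ (d_set_graph_set dn d0)).
set T : R := 2 ^+ d.+1; have T0 : 0 < T by rewrite exprn_gt0.
have gap : 0 < 1 - 2 * s by lra.
(* The first summand makes [d * T / M < 1 - 2 * s], so that Bernoulli's inequality gives a density
   bound above [s]; the second makes [T < M]. *)
pose M := (Num.truncn (d%:R * T / (1 - 2 * s)) + (Num.truncn T).+2)%N.
have MT : T < M%:R.
  by rewrite (lt_trans (truncnS_gt _))// ltr_nat /M leq_addl.
have M0 : 0 < M%:R :> R by apply: lt_trans MT.
have MdT : d%:R * T < (1 - 2 * s) * M%:R.
  rewrite [ltRHS]mulrC -ltr_pdivrMr//.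
  by rewrite (lt_le_trans (truncnS_gt _))// ler_nat /M addnS ltnS leq_addr.
have sM : s < (1 - T / M%:R) ^+ d / 2.
  have tM : 0 <= T / M%:R <= 1.
    by rewrite divr_ge0 ?(ltW T0)//= ler_pdivrMr// mul1r ltW.
  have := bernoulli_le d tM.
  have : d%:R * (T / M%:R) < 1 - 2 * s by rewrite mulrA ltr_pdivrMr.
  lra.
(* The points of density at most [s] lie in the graph over [corner_limit], which is null. *)
apply/eqP; rewrite eq_le -{1}(hausdorff_corner_limit dn d0 M); apply/andP; split; last first.
  rewrite (le_trans _ (hausdorff_delta_le d _ ltr01))// hausdorff_delta_ge0//.
rewrite !hausdorffE; apply: ub_ereal_sup => _ [delta delta0 <-].
apply: le_trans (ereal_sup_ubound _); last by exists delta.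
apply: le_hausdorff_delta_set => _ [[x x1 <-] nd]; exists x => //.
apply: contrapT => nx; apply: nd; apply: lt_le_trans (density_bound dn d0 x1 nx MT).
by rewrite lte_fin.
Qed.
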